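(* Let $Y$ be a smooth manifold of dimension $m$, let $1\le k\le m$, and let $S\subset Y$ be a $k$-dimensional submanifold. Suppose that $S$ is oriented. Then the subset $G^kS$ of the Grassmann fibration $G^kY$ is a $k$-dimensional oriented submanifold of $G^kY$, diffeomorphic with $S$.
   Context: Submanifold: a subset $S\subset Y$ is a $k$-dimensional submanifold if at every point $y_0\in S$ there is a chart $(V,\psi)$, $\psi=(y^\sigma)$, of $Y$ such that $V\cap S=\{y\in V \mid y^{k+1}(y)=0,\ldots,y^m(y)=0\}$. Such a chart is called adapted to $S$ (a submanifold chart; constants have been normalised to $0$). When $S$ is oriented, only adapted charts $(V,\psi)$ for which $(y^1,\ldots,y^k)$ restricted to $V\cap S$ is a positively oriented chart of $S$ are used. Bundle of $k$-vectors: $\Lambda^kTY=\bigcup_{y\in Y}\Lambda^kT_yY$ is the vector bundle over $Y$ of $k$-vectors, and $\Lambda^k_0TY\subset\Lambda^kTY$ is the open subset of non-zero $k$-vectors. Grassmann fibration: $G^kY$ is the quotient of $\Lambda^k_0TY$ by the equivalence relation ''$\Xi_1\sim\Xi_2$ if and only if $\Xi_1=\lambda\Xi_2$ for some real $\lambda>0$'' (equivalent $k$-vectors lie over the same point of $Y$). The class of $\Xi$ is denoted $[\Xi]$ and the quotient projection is $\kappa^k:\Lambda^k_0TY\to G^kY$. $G^kY$ is a smooth fibration over $Y$, with the smooth structure for which $\kappa^k$ is a smooth submersion. In coordinates: if $(y^\sigma,\dot y^{\sigma_1\ldots\sigma_k})$ are the coordinates on $\Lambda^kTY$ induced by a chart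 $(V,\psi)$ of $Y$, then on the image in $G^kY$ of the set of $k$-vectors over $V$ with $\dot y^{\nu_1\ldots\nu_k}>0$ (with $\nu_1,\ldots,\nu_k$ fixed) a fibred chart is given by $w^\sigma=y^\sigma$ and $w^{\sigma_1\ldots\sigma_k}=\dot y^{\sigma_1\ldots\sigma_k}/\dot y^{\nu_1\ldots\nu_k}$ for $(\sigma_1\ldots\sigma_k)\neq(\nu_1\ldots\nu_k)$. Lifts: for a differentiable mapping $f:U\to Y$, $U\subset\mathbb{R}^k$ open, the canonical lift is $\Lambda^kf(t)=\Lambda^kT_tf\cdot\left(\frac{\partial}{\partial t^1}\wedge\cdots\wedge\frac{\partial}{\partial t^k}\right)_t\in\Lambda^kT_{f(t)}Y$. Let $\iota_{k,m}:\mathbb{R}^k\to\mathbb{R}^m$, $\iota_{k,m}(t)=(t,0,\ldots,0)$, and let $\mathrm{pr}_{m,k}:\mathbb{R}^m\to\mathbb{R}^k$ be the projection on the first $k$ coordinates. For an adapted chart $(V,\psi)$ put $G^k(\psi^{-1}\iota_{k,m})=\kappa^k\circ\Lambda^k(\psi^{-1}\circ\iota_{k,m})$, defined on $\iota_{k,m}^{-1}(\psi(V))$. The set $G^kS$: $$G^kS=\{[\Xi]\in G^kY \mid [\Xi]=G^k(\psi^{-1}\iota_{k,m})(\mathrm{pr}_{m,k}\,\psi(y)),\ y\in S\},$$ where for each $y\in S$ the chart $(V,\psi)$ is any adapted chart at $y$ belonging to the orientation of $S$. Equivalently, the element of $G^kS$ over $y\in S$ is the class of $\left(\frac{\partial}{\partial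 y^1}\right)_y\wedge\cdots\wedge\left(\frac{\partial}{\partial y^k}\right)_y$. *)

(* Defs.v *)
From HB Require Import structures.
From mathcomp Require Import all_boot all_order all_algebra.
From mathcomp Require Import all_classical all_reals all_analysis.

Set Implicit Arguments.
Unset Strict Implicit.
Unset Printing Implicit Defensive.

Import Order.TTheory GRing.Theory Num.Theory numFieldNormedType.Exports.
Local Open Scope classical_set_scope.
Local Open Scope ring_scope.

Fixpoint Cr_on (R : realType) (n p r : nat) (U : set 'rV[R]_n)
    (f : 'rV[R]_n -> 'rV[R]_p) : Prop :=
  match r with
  | 0%N => forall x, U x -> {for x, continuous f}
  | r'.+1 => (forall x, U x -> differentiable f x) /\
             (forall v : 'rV[R]_n, Cr_on r' U (fun x => 'D_v f x))
  end.

Definition smooth_on (R : realType) (n p : nat) (U : set 'rV[R]_n)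
    (f : 'rV[R]_n -> 'rV[R]_p) : Prop :=
  forall r, Cr_on r U f.

(* [cmap] is a total function, but only its values on [cdom] are meaningful. *)
Record chart (R : realType) (T : Type) (n : nat) := Chart {
  cdom : set T;
  cmap :> T -> 'rV[R]_n
}.

(* [c] is a chart of the set [X]: a bijection from a subset of [X] onto an open
   subset of R^n. *)
Definition chart_on (R : realType) (T : Type) (n : nat) (X : set T)
    (c : chart R T n) : Prop :=
  [/\ cdom c `<=` X, set_inj (cdom c) c & open (c @` cdom c)].

(* The coordinate change c2 o c1^-1; it is 0 outside c1 (dom c1 `&` dom c2). *)
Definition transition (R : realType) (T : Type) (n : nat)
    (c1 c2 : chart R T n) : 'rV[R]_n -> 'rV[R]_n :=
  fun x => xget 0 [set z | exists p,
    [/\ cdom c1 p, cdom c2 p, c1 p = x & c2 p = z]].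

Definition smooth_change (R : realType) (T : Type) (n : nat)
    (c1 c2 : chart R T n) : Prop :=
  open (c1 @` (cdom c1 `&` cdom c2)) /\
  smooth_on (c1 @` (cdom c1 `&` cdom c2)) (transition c1 c2).

Definition compatible (R : realType) (T : Type) (n : nat)
    (c1 c2 : chart R T n) : Prop :=
  smooth_change c1 c2 /\ smooth_change c2 c1.

Definition positively_related (R : realType) (T : Type) (n : nat)
    (c1 c2 : chart R T n) : Prop :=
  forall p, cdom c1 p -> cdom c2 p ->
    0 < \det (jacobian (transition c1 c2) (c1 p)).

Definition covers (R : realType) (T : Type) (n : nat) (X : set T)
    (A : set (chart R T n)) : Prop :=
  forall p, X p -> exists2 c, A c & cdom c p.

(* The smooth structure on [X] generated by an atlas [B] of [X].  The topology
   of [X] is the one its charts induce. *)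
Definition maximal_atlas (R : realType) (T : Type) (n : nat) (X : set T)
    (B : set (chart R T n)) : set (chart R T n) :=
  [set c | chart_on X c /\ forall b, B b -> compatible c b].

Definition chart_homeo (R : realType) (T : topologicalType) (n : nat)
    (c : chart R T n) : Prop :=
  [/\ open (cdom c),
      forall p, cdom c p -> {for p, continuous c} &
      forall O : set T, open O -> O `<=` cdom c -> open (c @` O)].

(* [A] makes the topological space [Y] a smooth manifold of dimension [m].  The
   fixed-point equation says both that charts in [A] are pairwise compatible and
   that [A] is maximal. *)
Definition smooth_manifold (R : realType) (Y : topologicalType) (m : nat)
    (A : set (chart R Y m)) : Prop :=
  [/\ hausdorff_space Y, @second_countable Y, covers setT A,
      forall c, A c -> chart_homeo c &
      A = maximal_atlas setT A].

(* An orientation of the manifold ([X], [A]), of positive dimension: the set of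
   positively oriented charts. *)
Definition orientation (R : realType) (T : Type) (n : nat) (X : set T)
    (A O : set (chart R T n)) : Prop :=
  covers X O /\
  O = [set c | A c /\ forall c', O c' -> positively_related c c'].

(* Reading a chart of [X'] through f : X -> X'. *)
Definition pullback_chart (R : realType) (T T' : Type) (n : nat) (X : set T)
    (f : T -> T') (c : chart R T' n) : chart R T n :=
  Chart (X `&` f @^-1` cdom c) (c \o f).

(* The transition from [c] to the pullback of [c'] is c' o f o c^-1, and the
   transition in the other direction is c o f^-1 o c'^-1. *)
Definition diffeomorphism (R : realType) (T T' : Type) (n : nat)
    (X : set T) (A : set (chart R T n)) (X' : set T') (A' : set (chart R T' n))
    (f : T -> T') : Prop :=
  set_bij X X' f /\
  forall c c', A c -> A' c' -> compatible c (pullback_chart X f c').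

Definition orientation_preserving (R : realType) (T T' : Type) (n : nat)
    (X : set T) (O : set (chart R T n)) (O' : set (chart R T' n))
    (f : T -> T') : Prop :=
  forall c c', O c -> O' c' -> positively_related c (pullback_chart X f c').

(* For k <= m this is the inclusion t |-> (t, 0, ..., 0) of R^k into R^m, or the
   projection of R^m on the first k coordinates, according to its type. *)
Definition resize (R : realType) (n p : nat) (x : 'rV[R]_n) : 'rV[R]_p :=
  \row_(i < p) oapp (fun j : 'I_n => x 0 j) 0 (insub (val i)).
Arguments resize {R n} p x.

Definition adapted (R : realType) (T : Type) (m : nat) (A : set (chart R T m))
    (k : nat) (S : set T) (c : chart R T m) : Prop :=
  A c /\ cdom c `&` S =
         [set y | cdom c y /\ forall j : 'I_m, (k <= j)%N -> c y 0 j = 0].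

Definition submanifold (R : realType) (T : Type) (m : nat)
    (A : set (chart R T m)) (k : nat) (S : set T) : Prop :=
  forall y, S y -> exists2 c, adapted A k S c & cdom c y.

Definition restrict_chart (R : realType) (T : Type) (m : nat) (k : nat)
    (S : set T) (c : chart R T m) : chart R T k :=
  Chart (cdom c `&` S) (fun y => resize k (c y)).
Arguments restrict_chart {R T m} k S c.

Definition submanifold_atlas (R : realType) (T : Type) (m : nat)
    (A : set (chart R T m)) (k : nat) (S : set T) : set (chart R T k) :=
  maximal_atlas S (restrict_chart k S @` [set c | adapted A k S c]).
Arguments submanifold_atlas {R T m} A k S.

Definition multiindex (k n : nat) :=
  {I : k.-tuple 'I_n | sorted (fun i j : 'I_n => (i < j)%N) I}.

(* Lambda^k R^n in its standard basis; a k-vector is given by its components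
   with increasing indices. *)
Definition ext_power (R : realType) (k n : nat) := {ffun multiindex k n -> R}.

(* Lambda^k of the linear map v |-> v *m L. *)
Definition ext_power_map (R : realType) (k n p : nat) (L : 'M[R]_(n, p))
    (w : ext_power R k n) : ext_power R k p :=
  [ffun J : multiindex k p => \sum_(I : multiindex k n)
     w I * \det (mxsub (tnth (val I)) (tnth (val J)) L)].

(* d/dt^1 /\ ... /\ d/dt^k; (1, ..., k) is the only increasing multi-index. *)
Definition std_kvector (R : realType) (k : nat) : ext_power R k k :=
  [ffun=> 1].

(* A k-vector at a point y of Y, given by its components in all charts at y;
   see [kvectors] for the transformation rule. *)
Definition kvector (R : realType) (Y : Type) (m k : nat) : Type :=
  (Y * (chart R Y m -> ext_power R k m))%type.

(* Lambda^k TY.  Components in charts that are not charts at the base point are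
   set to 0, so that a k-vector is determined by its actual components. *)
Definition kvectors (R : realType) (Y : Type) (m : nat)
    (A : set (chart R Y m)) (k : nat) : set (kvector R Y m k) :=
  [set Xi |
    (forall c c', A c -> A c' -> cdom c Xi.1 -> cdom c' Xi.1 ->
       Xi.2 c' =
       ext_power_map (jacobian (transition c c') (c Xi.1)) (Xi.2 c)) /\
    (forall c, ~ (A c /\ cdom c Xi.1) -> Xi.2 c = 0)].
Arguments kvectors {R Y m} A k.

Definition nonzero_kvectors (R : realType) (Y : Type) (m : nat)
    (A : set (chart R Y m)) (k : nat) : set (kvector R Y m k) :=
  [set Xi | kvectors A k Xi /\ exists c, Xi.2 c <> 0].
Arguments nonzero_kvectors {R Y m} A k.

Definition kvector_equiv (R : realType) (Y : Type) (m k : nat)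
    (Xi1 Xi2 : kvector R Y m k) : Prop :=
  Xi1.1 = Xi2.1 /\
  exists2 lambda : R, 0 < lambda & forall c, Xi1.2 c = lambda *: Xi2.2 c.

(* Lambda^k f (t) for f : R^k -> Y. *)
Definition canonical_lift (R : realType) (Y : Type) (m : nat)
    (A : set (chart R Y m)) (k : nat) (f : 'rV[R]_k -> Y) (t : 'rV[R]_k) :
    kvector R Y m k :=
  (f t, fun c => if `[< A c /\ cdom c (f t) >]
                 then ext_power_map (jacobian (c \o f) t) (std_kvector R k)
                 else 0).

(* The quotient projection; points of G^k Y are equivalence classes. *)
Definition kappa (R : realType) (Y : Type) (m : nat) (A : set (chart R Y m))
    (k : nat) (Xi : kvector R Y m k) : set (kvector R Y m k) :=
  [set Xi' | nonzero_kvectors A k Xi' /\ kvector_equiv Xi' Xi].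
Arguments kappa {R Y m} A {k} Xi.

Definition grassmann (R : realType) (Y : Type) (m : nat)
    (A : set (chart R Y m)) (k : nat) : set (set (kvector R Y m k)) :=
  kappa A @` nonzero_kvectors A k.
Arguments grassmann {R Y m} A k.

(* m + 'C(m, k) - 1. *)
Definition grassmann_dim (m k : nat) : nat := (m + #|{: multiindex k m}|.-1)%N.

(* The coordinates (w^sigma, w^(sigma_1 ... sigma_k)) of the class of [Xi]; the
   multi-indices other than [nu] are enumerated by [lift (enum_rank nu)]. *)
Definition fibred_coordinates (R : realType) (Y : Type) (m k : nat)
    (c : chart R Y m) (nu : multiindex k m) (Xi : kvector R Y m k) :
    'rV[R]_(grassmann_dim m k) :=
  row_mx (c Xi.1)
    (\row_(j < #|{: multiindex k m}|.-1)
       (Xi.2 c (enum_val (lift (enum_rank nu) j)) / Xi.2 c nu)).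

(* The fibred chart of G^k Y on the image of {ydot^nu > 0}. The choice of the
   representative [Xi] of the class [X] is immaterial. *)
Definition fibred_chart (R : realType) (Y : Type) (m : nat)
    (A : set (chart R Y m)) (k : nat) (c : chart R Y m)
    (nu : multiindex k m) :
    chart R (set (kvector R Y m k)) (grassmann_dim m k) :=
  Chart (kappa A @` [set Xi | [/\ nonzero_kvectors A k Xi, cdom c Xi.1 &
                                  0 < Xi.2 c nu]])
        (fun X => xget 0 (fibred_coordinates c nu @` X)).

(* Increasing [nu] suffice: [A] also contains the charts obtained from [c] by
   changing the sign of a coordinate. *)
Definition grassmann_atlas (R : realType) (Y : Type) (m : nat)
    (A : set (chart R Y m)) (k : nat) :
    set (chart R (set (kvector R Y m k)) (grassmann_dim m k)) :=
  maximal_atlas (grassmann A k)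
    [set C | exists c nu, A c /\ C = fibred_chart A c nu].
Arguments grassmann_atlas {R Y m} A k.

(* psi^-1; its value outside the range of psi is irrelevant. *)
Definition chart_inv (R : realType) (Y : choiceType) (m : nat)
    (c : chart R Y m) (y0 : Y) : 'rV[R]_m -> Y :=
  fun x => xget y0 [set y | cdom c y /\ c y = x].

(* G^k (psi^-1 o iota_{k,m}). *)
Definition grassmann_lift (R : realType) (Y : choiceType) (m : nat)
    (A : set (chart R Y m)) (k : nat) (c : chart R Y m) (y0 : Y)
    (t : 'rV[R]_k) : set (kvector R Y m k) :=
  kappa A (canonical_lift A (fun s => chart_inv c y0 (resize m s)) t).

(* G^k S, for S oriented by [O]. *)
Definition GkS (R : realType) (Y : choiceType) (m : nat)
    (A : set (chart R Y m)) (k : nat) (S : set Y) (O : set (chart R Y k)) :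
    set (set (kvector R Y m k)) :=
  [set X | grassmann A k X /\ exists y c,
     [/\ S y, adapted A k S c, cdom c y, O (restrict_chart k S c) &
         X = grassmann_lift A c y (resize k (c y))]].

(* Main.v *)
(* Read in a chart c of Y adapted to S and the first multi-index nu0 = (1, ..., k),
   the point of G^k S over y in S is the class of the k-vector with the single
   component 1 at nu0.  So the fibred chart (c, nu0) sends G^k S to the points
   (x, w) with x^{k+1} = ... = x^m = 0 and w = 0: it is adapted to G^k S as it
   stands, and its restriction to G^k S is the restriction of c to S, transported
   by the section y |-> (class over y).  Smooth structure and orientation are then
   carried from S to G^k S by that section.  The class over y does not depend on c
   because a change of positively oriented adapted charts multiplies the k-vector
   by the positive determinant of the change of coordinates of S.  That fibred
   charts are compatible rests on the functoriality of Lambda^k, i.e. on the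
   Cauchy-Binet formula. *)

(* Classes are taken modulo positive factors only, so a point of G^k Y is an oriented k-plane, and a
   section over S requires positively oriented adapted charts at every point of S. An orientation
   consists of charts of S, which need not be restrictions of adapted charts of Y; an adapted chart
   of the wrong sign has to be corrected by a reflection. The reflected coordinate must be tangent
   to S, and k >= 1 makes the first one available. The smooth structures on S and G^k S are given by
   charts alone. Two charts are therefore compared by inserting an intermediate chart at each common
   point and gluing the resulting local statements. *)
Require Import Defs.
From HB Require Import structures.
From mathcomp Require Import all_boot all_order all_algebra fingroup perm.
From mathcomp Require Import all_classical all_reals all_analysis.

Set Implicit Arguments.
Unset Strict Implicit.
Unset Printing Implicit Defensive.

Import Order.TTheory GRing.Theory Num.Theory numFieldNormedType.Exports.
Local Open Scope ring_scope.

(** * Minors and the functoriality of exterior powers *)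

Section Minors.

Section Multiindices.
Variables (k n : nat).
Implicit Types I J : multiindex k n.

Lemma multiindex_sorted I : sorted ltn (map val (val I)).
Proof. by rewrite sorted_map; exact: (valP I). Qed.

Lemma multiindex_inj I : injective (tnth (val I)).
Proof.
apply/tuple_uniqP.
by rewrite -(map_inj_uniq val_inj) (sorted_uniq ltn_trans ltnn) // multiindex_sorted.
Qed.

Lemma multiindex_eq I J : val I =i val J -> I = J.
Proof.
move=> IJ; apply/val_inj/val_inj/(inj_map val_inj).
apply: (irr_sorted_eq ltn_trans ltnn); rewrite ?multiindex_sorted // => y.
by apply/mapP/mapP => -[x xI ->]; exists x; rewrite // ?IJ // -IJ.
Qed.

(** Both tuples have k distinct entries, so inclusion already forces equality. *)
Lemma multiindex_sub I J : {subset val I <= val J} -> I = J.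
Proof.
move=> IJ; apply: multiindex_eq.
have uI : uniq (val I) by exact/tuple_uniqP/multiindex_inj.
by have [|] := uniq_min_size uI IJ; rewrite ?size_tuple.
Qed.

Lemma card_multiindex : #|{: multiindex k n}| = 'C(n, k).
Proof.
rewrite -card_ltn_sorted_tuples card_sig; apply: eq_card => t.
by rewrite !inE sorted_map.
Qed.

End Multiindices.

(** * The Cauchy-Binet formula *)

Section CauchyBinet.
Variables (R : comNzRingType) (k p : nat).

(** An injection of 'I_k into 'I_p is uniquely an increasing one precomposed with a permutation;
    this is the injection encoded by such a pair. *)
Definition arrangement (u : multiindex k p * {perm 'I_k}) : {ffun 'I_k -> 'I_p} :=
  [ffun i => tnth (val u.1) (u.2 i)].

Lemma arrangement_inj : injective arrangement.
Proof.
move=> [I s] [J t] /ffunP e; have {}e i : tnth (val I) (s i) = tnth (val J) (t i).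
  by have := e i; rewrite !ffunE.
suff IJ : I = J.
  rewrite IJ in e *; congr pair; apply/permP => i; exact: multiindex_inj (e i).
apply: multiindex_sub => x /tnthP[i ->]; rewrite -[i](permKV s) e.
exact: mem_tnth.
Qed.

(** Counting replaces the construction of a sorting permutation: [arrangement] is injective, and
    there are 'C(p, k) * k! pairs, as many as injections. *)
Lemma arrangement_image :
  arrangement @: [set: multiindex k p * {perm 'I_k}] = [set f : {ffun 'I_k -> 'I_p} | injectiveb f].
Proof.
apply/eqP; rewrite eqEcard card_inj_ffuns card_imset; last exact: arrangement_inj.
have -> : #|[set: multiindex k p * {perm 'I_k}]| = (p ^_ k)%N.
  rewrite cardsT card_prod card_multiindex -bin_ffact; congr (_ * _)%N.
  exact: card_Sn.
rewrite !card_ord leqnn andbT.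
apply/fintype.subsetP => _ /imsetP[[I s] _ ->]; rewrite inE; apply/injectiveP => i j.
by rewrite !ffunE => /multiindex_inj/perm_inj.
Qed.

(** Multilinearity in the rows of the product gives a sum over all maps f from 'I_k to 'I_p.
    Non-injective f repeat a row of [B] and contribute 0; the injective ones are grouped by their
    image, an increasing multi-index. *)
Lemma det_mulmx_minors (A : 'M[R]_(k, p)) (B : 'M[R]_(p, k)) :
  \det (A *m B) = \sum_(I : multiindex k p)
    \det (colsub (tnth (val I)) A) * \det (rowsub (tnth (val I)) B).
Proof.
pose F (f : {ffun 'I_k -> 'I_p}) := (\prod_i A i (f i)) * \det (rowsub f B).
transitivity (\sum_f F f).
  transitivity (\sum_(f : {ffun 'I_k -> 'I_p}) \sum_(s : 'S_k)
      (-1) ^+ s * \prod_i (A i (f i) * B (f i) (s i))).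
    rewrite exchange_big; apply: eq_bigr => /= s _; rewrite -big_distrr /=.
    congr (_ * _); rewrite -(bigA_distr_bigA (fun i j => A i j * B j (s i))) /=.
    by apply: eq_bigr => x _; rewrite mxE.
  apply: eq_bigr => f _; rewrite /F [X in _ * X]/determinant big_distrr /=.
  apply: eq_bigr => s _; rewrite big_split /= mulrCA; congr (_ * (_ * _)).
  by apply: eq_bigr => i _; rewrite mxE.
rewrite (bigID (fun f : {ffun 'I_k -> 'I_p} => injectiveb f)) /=.
rewrite [X in _ + X]big1 ?addr0; last first.
  move=> f /injectivePn[i [j ij fij]].
  by rewrite /F (determinant_alternate ij) ?mulr0 // => l; rewrite !mxE fij.
rewrite (eq_bigl (fun f => f \in arrangement @: [set: multiindex k p * {perm 'I_k}])); last first.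
  by move=> f; have /setP/(_ f) := arrangement_image; rewrite [RHS]inE => <-.
rewrite big_imset /=; last by move=> x y _ _; exact: arrangement_inj.
rewrite (eq_bigl xpredT) => [|u]; last by rewrite inE.
rewrite -(pair_bigA _ (fun I s => F (arrangement (I, s)))) /=.
apply: eq_bigr => I _; rewrite /determinant big_distrl /=.
apply: eq_bigr => s _; rewrite /F.
(* Sorting the rows of the minor of [B] produces the sign of [s], which is the sign needed in the
   Leibniz expansion of the minor of [A]. *)
have -> : rowsub (arrangement (I, s)) B = row_perm s (rowsub (tnth (val I)) B).
  by apply/matrixP => i j; rewrite !mxE ffunE.
rewrite row_permE det_mulmx det_perm -/(determinant _).
rewrite mulrCA mulrA; congr (_ * _ * _).
by apply: eq_bigr => i _; rewrite mxE ffunE.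
Qed.

End CauchyBinet.

Section ExtPower.
Variables (R : realType) (k : nat).

(** On components this is Cauchy-Binet for the minors of [L *m M]; matrices act on row vectors from
    the right, so [L] comes first. *)
Lemma ext_power_mapM n p q (L : 'M[R]_(n, p)) (M : 'M[R]_(p, q)) (w : ext_power R k n) :
  ext_power_map M (ext_power_map L w) = ext_power_map (L *m M) w.
Proof.
apply/ffunP => J; rewrite !ffunE.
under eq_bigr do rewrite ffunE big_distrl /=.
rewrite exchange_big /=; apply: eq_bigr => I _.
rewrite mxsub_mul det_mulmx_minors big_distrr /=; apply: eq_bigr => K _.
by rewrite -mulrA; congr (_ * (_ * _)); congr determinant; apply/matrixP => i j; rewrite !mxE.
Qed.

Lemma minor1 n (I J : multiindex k n) :
  \det (mxsub (tnth (val I)) (tnth (val J)) (1%:M : 'M[R]_n)) = (I == J)%:R.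
Proof.
case: eqVneq => [<-|neq].
  rewrite (_ : mxsub _ _ _ = 1%:M) ?det1 //.
  by apply/matrixP => i j; rewrite !mxE (inj_eq (@multiindex_inj _ _ I)).
(* A row index of [I] missing from [J] gives a zero row in the submatrix of the identity. *)
have [i iJ] : exists i, tnth (val I) i \notin val J.
  apply: contrapT => /forallNP h; move/eqP: neq; apply.
  by apply: multiindex_sub => x /tnthP[i ->]; have /negP := h i; rewrite negbK.
rewrite (expand_det_row _ i) big1 // => j _; rewrite !mxE.
by case: eqP => [e|_]; [rewrite e mem_tnth in iJ|rewrite mul0r].
Qed.

Lemma ext_power_map1 n (w : ext_power R k n) : ext_power_map 1%:M w = w.
Proof.
apply/ffunP => J; rewrite ffunE (bigD1 J) //= minor1 eqxx mulr1 big1 ?addr0 //.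
by move=> I IJ; rewrite minor1 (negPf IJ) mulr0.
Qed.

Lemma ext_power_mapZ n p (L : 'M[R]_(n, p)) (a : R) (w : ext_power R k n) :
  ext_power_map L (a *: w) = a *: ext_power_map L w.
Proof.
apply/ffunP => J; rewrite !ffunE scaler_sumr; apply: eq_bigr => I _.
by rewrite ffunE /= -mulrA.
Qed.

Lemma multiindex_full_subproof : sorted (fun i j : 'I_k => (i < j)%N) (ord_tuple k).
Proof. by have := iota_ltn_sorted 0 k; rewrite -val_enum_ord sorted_map. Qed.

Definition multiindex_full : multiindex k k := exist _ (ord_tuple k) multiindex_full_subproof.

Lemma multiindex_fullP (I : multiindex k k) : I = multiindex_full.
Proof. by apply: multiindex_sub => x _; rewrite /= mem_enum. Qed.

Lemma ext_power_map_std n (L : 'M[R]_(k, n)) J :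
  ext_power_map L (std_kvector R k) J = \det (colsub (tnth (val J)) L).
Proof.
rewrite ffunE (bigD1 multiindex_full) //= ffunE mul1r big1 ?addr0.
  by congr determinant; apply/matrixP => i j; rewrite !mxE tnth_ord_tuple.
by move=> I; rewrite (multiindex_fullP I) eqxx.
Qed.

Lemma ext_power_map_std_det (L : 'M[R]_k) :
  ext_power_map L (std_kvector R k) = \det L *: std_kvector R k.
Proof.
apply/ffunP => J; rewrite ext_power_map_std !ffunE [RHS]mulr1 (multiindex_fullP J).
by congr determinant; apply/matrixP => i j; rewrite !mxE tnth_ord_tuple.
Qed.

End ExtPower.
End Minors.

Local Open Scope classical_set_scope.
Local Open Scope ring_scope.

(** * Calculus of smooth maps *)

Section Calculus.
Variable R : realType.

(** The difference [g - f] vanishes near [x], so 0 is its differential there. *)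
Lemma near_differentiable (V W : normedModType R) (f g : V -> W) (x : V) :
  (\near x, f x = g x) -> differentiable f x -> differentiable g x.
Proof.
move=> fg df; have -> : g = f + (g - f) by rewrite addrC subrK.
apply: (differentiableD df); set h := g - f.
have h0 : \forall y \near x, h y = 0.
  by near=> y; apply/eqP; rewrite subr_eq0; apply/eqP; symmetry; near: y.
have hx : h x = 0 by exact: nbhs_singleton h0.
have hE : h \o shift x = cst (h x) + (\0 : {linear V -> W}) +o_ 0 id.
  apply/eqaddoP => _/posnumP[e]; rewrite hx.
  move: h0; rewrite (near_shift 0 x) subr0; apply: filterS => y /= hy.
  by rewrite !fctE /= hy addr0 subr0 normr0 mulr_ge0.
have c0 : continuous (\0 : {linear V -> W}) by exact: cst_continuous.
by apply/diff_locallyP; rewrite (diff_unique c0 hE).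
Unshelve. all: by end_near. Qed.


(** [Cr_on] with values in any normed module, so that scalar functions such as coordinates and
    minors fall under the same inductions. *)
Fixpoint Ck (n : nat) (W : normedModType R) (r : nat) (U : set 'rV[R]_n)
    (f : 'rV[R]_n -> W) : Prop :=
  match r with
  | 0%N => forall x, U x -> {for x, continuous f}
  | r'.+1 => (forall x, U x -> differentiable f x) /\
             (forall v : 'rV[R]_n, Ck r' U (fun x => 'D_v f x))
  end.

Lemma Cr_onE n p r (U : set 'rV[R]_n) (f : 'rV[R]_n -> 'rV[R]_p) :
  Cr_on r U f <-> Ck r U f.
Proof.
elim: r f => [//|r IH] f /=.
by split=> -[df Df]; split => // v; apply/IH.
Qed.

Section Domain.
Variables (n : nat) (W : normedModType R).
Implicit Types (U : set 'rV[R]_n) (f g : 'rV[R]_n -> W).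

(** Openness of [U] turns agreement on [U] into agreement near each of its points, which is what
    derivatives depend on. Later inductions use this to replace a derivative by its formula. *)
Lemma Ck_ext r U f g : open U -> (forall x, U x -> f x = g x) ->
  Ck r U f -> Ck r U g.
Proof.
move=> Uo; elim: r f g => [|r IH] f g fg /=.
  move=> cf x Ux; have nfg : \near x, f x = g x.
    by apply: filterS fg _; exact: open_nbhs_nbhs.
  rewrite /prop_for /continuous_at -(nbhs_singleton nfg).
  exact: cvg_trans (near_eq_cvg nfg) (cf x Ux).
have nfg x : U x -> \near x, f x = g x.
  by move=> Ux; apply: filterS fg _; exact: open_nbhs_nbhs.
move=> [df Df]; split.
  by move=> x Ux; apply: near_differentiable (nfg x Ux) (df x Ux).
move=> v; apply: IH (Df v) => x Ux; exact: near_eq_derive (nfg x Ux).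
Qed.

Lemma CkS r U f : Ck r.+1 U f -> Ck r U f.
Proof.
elim: r f => [|r IH] f [df Df].
  by move=> x Ux; exact: differentiable_continuous (df x Ux).
by split=> // v; exact: IH.
Qed.

Lemma Ck_sub r U U' f : U' `<=` U -> Ck r U f -> Ck r U' f.
Proof.
move=> sub; elim: r f => [|r IH] f /=; first by move=> + x /sub; exact.
by move=> [df Df]; split=> [x /sub /df//|v]; exact: IH.
Qed.

Lemma Ck_cst r U (a : W) : Ck r U (cst a).
Proof.
elim: r a => [|r IH] a /=; first by move=> x _; exact: cst_continuous.
split=> [x _|v]; first exact: differentiable_cst.
have -> : (fun x => 'D_v (cst a) x) = cst 0 :> ('rV[R]_n -> W).
  by apply/funext => x; rewrite derive_cst.
exact: IH.
Qed.

Lemma CkD r U f g : open U -> Ck r U f -> Ck r U g -> Ck r U (fun x => f x + g x).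
Proof.
move=> Uo; elim: r f g => [|r IH] f g /=.
  by move=> cf cg x Ux; exact: cvgD (cf x Ux) (cg x Ux).
move=> [df Df] [dg Dg]; split.
  by move=> x Ux; apply: differentiableD; [exact: df|exact: dg].
move=> v; apply: Ck_ext (IH _ _ (Df v) (Dg v)) => // x Ux.
by symmetry; apply: deriveD; apply: diff_derivable; [exact: df|exact: dg].
Qed.

Lemma Ck_sum (I : Type) (s : seq I) (P : pred I) r U (F : I -> 'rV[R]_n -> W) :
  open U -> (forall i, P i -> Ck r U (F i)) ->
  Ck r U (fun x => \sum_(i <- s | P i) F i x).
Proof.
move=> Uo CF; elim: s => [|i s IH].
  by under eq_fun do rewrite big_nil; exact: Ck_cst.
under eq_fun do rewrite big_cons.
by case Pi : (P i) => //; apply: CkD => //; exact: CF.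
Qed.

End Domain.

Lemma CkM n r (U : set 'rV[R]_n) (f g : 'rV[R]_n -> R) :
  open U -> Ck r U f -> Ck r U g -> Ck r U (fun x => f x * g x).
Proof.
move=> Uo; elim: r f g => [|r IH] f g Cf Cg.
  by move=> x Ux; exact: cvgM (Cf x Ux) (Cg x Ux).
have [Cf' Cg'] := (CkS Cf, CkS Cg); case: Cf Cg => [df Df] [dg Dg]; split.
  by move=> x Ux; apply: differentiableM; [exact: df|exact: dg].
move=> v; have := CkD Uo (IH _ _ Cf' (Dg v)) (IH _ _ Cg' (Df v)); apply: Ck_ext => //.
move=> x Ux; symmetry.
by apply: deriveM; apply: diff_derivable; [exact: df|exact: dg].
Qed.

Lemma Ck_prod (I : Type) (s : seq I) (P : pred I) n r (U : set 'rV[R]_n)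
  (F : I -> 'rV[R]_n -> R) : open U -> (forall i, P i -> Ck r U (F i)) ->
  Ck r U (fun x => \prod_(i <- s | P i) F i x).
Proof.
move=> Uo CF; elim: s => [|i s IH].
  by under eq_fun do rewrite big_nil; exact: Ck_cst.
under eq_fun do rewrite big_cons.
by case Pi : (P i) => //; apply: CkM => //; exact: CF.
Qed.

Lemma CkV n r (U : set 'rV[R]_n) (f : 'rV[R]_n -> R) :
  open U -> (forall x, U x -> f x != 0) -> Ck r U f -> Ck r U (fun x => (f x)^-1).
Proof.
move=> Uo f0; elim: r => [|r IH] Cf.
  by move=> x Ux; exact: cvgV (f0 x Ux) (Cf x Ux).
have CVf := IH (CkS Cf); case: Cf => [df Df]; split.
  by move=> x Ux; apply: differentiableV; [exact: df|exact: f0].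
(* The derivative of 1/f is -(1/f)^2 'D_v f, so order r for 1/f, known by induction, gives order r +
   1. *)
move=> v; have := CkM Uo (@Ck_cst n R r U (-1)) (CkM Uo (CkM Uo CVf CVf) (Df v)).
apply: Ck_ext => //.
move=> x Ux /=; symmetry.
rewrite deriveV; [|exact: f0|exact/diff_derivable/df].
by rewrite -exprVn expr2 mulN1r scaleNr.
Qed.

Lemma Ck_det n r m (U : set 'rV[R]_n) (M : 'rV[R]_n -> 'M[R]_m) :
  open U -> (forall i j, Ck r U (fun x => M x i j)) ->
  Ck r U (fun x => \det (M x)).
Proof.
move=> Uo CM; rewrite /determinant; apply: Ck_sum => // s _.
by apply: CkM => //; [exact: Ck_cst|exact: Ck_prod].
Qed.

Lemma Ck_coordP n p r (U : set 'rV[R]_n) (f : 'rV[R]_n -> 'rV[R]_p) :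
  open U -> Ck r U f <-> forall i, Ck r U (fun x => f x 0 i).
Proof.
move=> Uo; have coordE (g : 'rV[R]_n -> 'rV[R]_p) :
    g = (fun x => \sum_(i < p) g x 0 i *: delta_mx 0 i).
  by apply/funext => x; rewrite -row_sum_delta.
elim: r f => [|r IH] f; split.
- move=> cf i x Ux; apply: (@continuous_comp _ _ _ f (fun M : 'rV[R]_p => M 0 i)).
    exact: cf.
  exact: coord_continuous.
- move=> cf; rewrite (coordE f); apply: (@Ck_sum _ _ _ _ _ 0) => // i _ x Ux.
  exact: cvgZr_tmp (cf i x Ux).
- move=> [df Df] i; split.
    move=> x Ux; apply: (@differentiable_comp _ _ _ _ f (fun M : 'rV[R]_p => M 0 i)).
      exact: df.
    exact: differentiable_coord.
  move=> v; have /IH/(_ i) := Df v; apply: Ck_ext => // x Ux.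
  by rewrite derive_mx ?mxE//; exact/diff_derivable/df.
- move=> Cf.
  have df x : U x -> differentiable f x.
    move=> Ux; rewrite (coordE f).
    have -> : (fun x => \sum_(i < p) f x 0 i *: delta_mx 0 i) =
        \sum_(i < p) (fun x => f x 0 i *: delta_mx 0 i) :> ('rV[R]_n -> 'rV[R]_p).
      by apply/funext => y; rewrite fct_sumE.
    apply: differentiable_sum => i; apply: differentiableZl.
    by have [+ _] := Cf i; exact.
  split=> // v; apply/IH => i; have [_ /(_ v)] := Cf i; apply: Ck_ext => // x Ux.
  by rewrite derive_mx ?mxE//; exact/diff_derivable/df.
Qed.

Lemma Ck_coord_fun n r (U : set 'rV[R]_n) i : Ck r U (fun x => x 0 i).
Proof.
have di x v : 'D_v (fun x : 'rV[R]_n => x 0 i) x = v 0 i.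
  have := @derive_mx _ _ _ _ id x v (@derivable_id _ _ x v); rewrite derive_id => /rowP/(_ i).
  by rewrite mxE.
case: r => [|r]; first by move=> x _; exact: coord_continuous.
split=> [x _|v]; first exact: differentiable_coord.
have -> : (fun x => 'D_v (fun x : 'rV[R]_n => x 0 i) x) = cst (v 0 i).
  by apply/funext => x; rewrite di.
exact: Ck_cst.
Qed.

Lemma Ck_comp n p r (U : set 'rV[R]_n) (V : set 'rV[R]_p)
    (f : 'rV[R]_n -> 'rV[R]_p) (g : 'rV[R]_p -> R) :
  open U -> open V -> (forall x, U x -> V (f x)) ->
  Ck r U f -> Ck r V g -> Ck r U (g \o f).
Proof.
move=> Uo Vo UV; elim: r g => [|r IH] g Cf Cg.
  by move=> x Ux; apply: continuous_comp; [exact: Cf|apply/Cg/UV].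
have Cf' := CkS Cf; case: Cf Cg => [df Df] [dg Dg]; split.
  by move=> x Ux; apply: differentiable_comp; [exact: df|apply/dg/UV].
move=> v.
(* The chain rule differentiates [g] in the direction 'D_v f x, which varies with x. Expanding it in
   the standard basis leaves derivatives of [g] in fixed directions, to which the induction
   applies. *)
apply: (@Ck_ext _ _ _ _
  (fun x => \sum_(i < p) 'D_v f x 0 i * 'D_(delta_mx 0 i) g (f x))) => // [x Ux|].
  have [dfx dgx] := (df x Ux, dg _ (UV x Ux)).
  have -> : 'D_v (g \o f) x = 'd g (f x) ('D_v f x).
    have := deriveE v (differentiable_comp dfx dgx).
    by rewrite diff_comp //= => ->; rewrite (deriveE v dfx).
  rewrite [in RHS](row_sum_delta ('D_v f x)) linear_sum.
  by apply: eq_bigr => i _; rewrite linearZ (deriveE _ dgx).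
apply: Ck_sum => // i _; apply: CkM => //; last exact: (IH ('D_(delta_mx 0 i) g) Cf' (Dg _)).
by have /(Ck_coordP _ _ Uo)/(_ i) := Df v.
Qed.

Lemma Ck_diff_entry n p r (U : set 'rV[R]_n) (f : 'rV[R]_n -> 'rV[R]_p) i j :
  open U -> Ck r.+1 U f -> Ck r U (fun x => jacobian f x i j).
Proof.
move=> Uo [df Df]; have /(Ck_coordP _ _ Uo)/(_ j) := Df (delta_mx 0 i).
by apply: Ck_ext => // x Ux; rewrite mxE deriveE //; exact: df.
Qed.

Lemma smooth_onP n p (U : set 'rV[R]_n) (f : 'rV[R]_n -> 'rV[R]_p) :
  open U -> smooth_on U f <-> forall i r, Ck r U (fun x => f x 0 i).
Proof.
move=> Uo; split=> [sf i r|sf r].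
  by move: i; apply/Ck_coordP => //; apply/Cr_onE.
by apply/Cr_onE/Ck_coordP.
Qed.

Lemma smooth_ext n p (U : set 'rV[R]_n) (f g : 'rV[R]_n -> 'rV[R]_p) :
  open U -> (forall x, U x -> f x = g x) -> smooth_on U f -> smooth_on U g.
Proof. by move=> Uo fg sf r; apply/Cr_onE; apply: Ck_ext fg _ => //; apply/Cr_onE. Qed.

Lemma smooth_sub n p (U V : set 'rV[R]_n) (f : 'rV[R]_n -> 'rV[R]_p) :
  V `<=` U -> smooth_on U f -> smooth_on V f.
Proof. by move=> VU sf r; apply/Cr_onE; apply: Ck_sub VU _; apply/Cr_onE. Qed.

Lemma smooth_differentiable n p (U : set 'rV[R]_n) (f : 'rV[R]_n -> 'rV[R]_p) x :
  smooth_on U f -> U x -> differentiable f x.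
Proof. by move=> /(_ 1%N)[+ _] Ux; exact. Qed.

Lemma smooth_continuous n p (U : set 'rV[R]_n) (f : 'rV[R]_n -> 'rV[R]_p) x :
  smooth_on U f -> U x -> {for x, continuous f}.
Proof. by move=> sf Ux; exact: (sf 0%N x Ux). Qed.

Lemma smooth_comp n p q (U : set 'rV[R]_n) (V : set 'rV[R]_p)
    (f : 'rV[R]_n -> 'rV[R]_p) (g : 'rV[R]_p -> 'rV[R]_q) :
  open U -> open V -> (forall x, U x -> V (f x)) ->
  smooth_on U f -> smooth_on V g -> smooth_on U (g \o f).
Proof.
move=> Uo Vo UV sf /(smooth_onP _ Vo) sg; apply/smooth_onP => // i r.
have /Cr_onE Cf := sf r.
exact: (Ck_comp (g := fun x => g x 0 i) Uo Vo UV Cf (sg i r)).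
Qed.

Lemma smooth_mulmx n p (U : set 'rV[R]_n) (M : 'M[R]_(n, p)) :
  open U -> smooth_on U (fun x => x *m M).
Proof.
move=> Uo; apply/smooth_onP => // i r.
under eq_fun do rewrite mxE.
apply: Ck_sum => // j _; apply: CkM => //; first exact: Ck_coord_fun.
exact: Ck_cst.
Qed.

Lemma open_preimage (T T' : topologicalType) (U : set T) (V : set T') (f : T -> T') :
  open U -> (forall x, U x -> {for x, continuous f}) -> open V ->
  open (U `&` f @^-1` V).
Proof.
move=> Uo fc Vo; rewrite openE => x [Ux Vfx]; apply: filterI.
  exact: open_nbhs_nbhs.
by apply: (fc x Ux); exact: open_nbhs_nbhs.
Qed.

Lemma mulmx_rowE n p (M : 'M[R]_(n, p)) (v : 'rV[R]_n) x :
  'd (fun x : 'rV[R]_n => x *m M) x v = v *m M.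
Proof.
have cM : continuous (mulmxr M : {linear 'rV[R]_n -> 'rV[R]_p}).
  by move=> y; exact: (smooth_continuous (smooth_mulmx M openT)).
exact: (congr1 (fun h => h v) (diff_lin x cM)).
Qed.

Lemma differentiable_mulmx n p (M : 'M[R]_(n, p)) (x : 'rV[R]_n) :
  differentiable (fun x : 'rV[R]_n => x *m M) x.
Proof. exact: smooth_differentiable (smooth_mulmx M openT) I. Qed.

Lemma jacobian_mulmx n p (M : 'M[R]_(n, p)) x :
  jacobian (fun x : 'rV[R]_n => x *m M) x = M.
Proof.
apply/row_matrixP => i.
by rewrite rowE mul_rV_lin1 mulmx_rowE -rowE.
Qed.

Lemma jacobian_comp n p q (f : 'rV[R]_n -> 'rV[R]_p) (g : 'rV[R]_p -> 'rV[R]_q) x :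
  differentiable f x -> differentiable g (f x) ->
  jacobian (g \o f) x = jacobian f x *m jacobian g (f x).
Proof.
move=> df dg; apply/row_matrixP => i.
by rewrite !rowE mulmxA !mul_rV_lin1 diff_comp.
Qed.

Lemma row_mulmx_inj n p (M N : 'M[R]_(n, p)) :
  (forall v : 'rV[R]_n, v *m M = v *m N) -> M = N.
Proof. by move=> MN; apply/row_matrixP => i; rewrite !rowE MN. Qed.

Lemma jacobian_near n p (f g : 'rV[R]_n -> 'rV[R]_p) (x : 'rV[R]_n) :
  (\near x, f x = g x) -> differentiable f x -> jacobian f x = jacobian g x.
Proof.
move=> fg df; have dg := near_differentiable fg df.
apply: row_mulmx_inj => v.
apply: etrans (esym (deriveEjacobian _ df)) _.
apply: etrans _ (deriveEjacobian _ dg).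
exact: near_eq_derive.
Qed.

Lemma jacobian_open n p (U : set 'rV[R]_n) (f g : 'rV[R]_n -> 'rV[R]_p) x :
  open U -> U x -> (forall y, U y -> f y = g y) ->
  differentiable f x -> jacobian f x = jacobian g x.
Proof.
move=> Uo Ux fg; apply: jacobian_near; apply: filterS fg _.
exact: open_nbhs_nbhs.
Qed.

(** Writing [resize] as multiplication by a matrix makes its smoothness and its Jacobian instances
    of the linear case. *)
Definition resize_mx n p : 'M[R]_(n, p) := \matrix_(i, j) (val i == val j)%:R.

Lemma resizeE n p (x : 'rV[R]_n) : resize p x = x *m resize_mx n p.
Proof.
apply/rowP => j; rewrite !mxE; case: insubP => [i lti ij|] /=.
  rewrite (bigD1 i) //= mxE ij eqxx mulr1 big1 ?addr0 // => i' ni'.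
  by rewrite mxE -ij (inj_eq val_inj) (negPf ni') mulr0.
move=> lj; rewrite big1 // => i _; rewrite mxE.
by case: eqP => [ij|]; [rewrite -ij ltn_ord in lj|rewrite mulr0].
Qed.

Lemma resize_mxK n p : (n <= p)%N -> resize_mx n p *m resize_mx p n = 1%:M.
Proof.
move=> np; apply/row_matrixP => i; apply/rowP => j; rewrite !mxE.
rewrite (bigD1 (widen_ord np i)) //= !mxE /= eqxx mul1r big1 ?addr0 // => l.
by rewrite !mxE -val_eqE /= eq_sym => /negPf ->; rewrite mul0r.
Qed.

Lemma resizeK n p : (n <= p)%N -> cancel (@resize R n p) (resize n).
Proof. by move=> np x; rewrite !resizeE -mulmxA resize_mxK // mulmx1. Qed.

Lemma resize0 n p (x : 'rV[R]_n) (j : 'I_p) : (n <= j)%N -> resize p x 0 j = 0.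
Proof. by move=> nj; rewrite mxE insubF // ltnNge nj. Qed.

Lemma resizeKV n p (x : 'rV[R]_p) : (n <= p)%N ->
  (forall j : 'I_p, (n <= j)%N -> x 0 j = 0) -> resize p (resize n x) = x.
Proof.
move=> np x0; apply/rowP => j; case: (ltnP j n) => [jn|nj]; last first.
  by rewrite resize0 ?x0.
rewrite mxE insubT /= mxE insubT ?ltn_ord //= => ltjp.
by congr (x 0 _); exact: val_inj.
Qed.

Lemma smooth_resize n p (U : set 'rV[R]_n) : open U -> smooth_on U (resize p).
Proof.
by move=> Uo; apply: smooth_ext (smooth_mulmx _ Uo) => // x _; rewrite resizeE.
Qed.

Lemma resize_continuous n p : continuous (@resize R n p).
Proof. by move=> x; exact: smooth_continuous (smooth_resize p openT) _. Qed.

End Calculus.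

(* Failed unifications of two Jacobians would otherwise unfold them forever. *)
#[local] Opaque jacobian.

(** * Charts, pullbacks and slices *)

Section Charts.
Variable R : realType.

(** The sets [V] may be arbitrary: each condition in [Ck] concerns the ambient function at single
    points. *)
Lemma Ck_local n (W : normedModType R) r (U : set 'rV[R]_n) (f : 'rV[R]_n -> W) :
  (forall x, U x -> exists2 V, V x & Ck r V f) -> Ck r U f.
Proof.
elim: r f => [|r IH] f loc /=.
  move=> x /loc[V Vx CV]; exact: CV x Vx.
split=> [x /loc[V Vx [df _]]|v]; first exact: df x Vx.
by apply: IH => x /loc[V Vx [_ Df]]; exists V => //; exact: Df v.
Qed.

Lemma smooth_local n p (U : set 'rV[R]_n) (f : 'rV[R]_n -> 'rV[R]_p) :
  (forall x, U x -> exists2 V, V x & smooth_on V f) -> smooth_on U f.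
Proof.
move=> loc r; apply/Cr_onE/Ck_local => x /loc[V Vx sf].
by exists V => //; exact/Cr_onE.
Qed.

Section OneSet.
Variables (T : Type) (n : nat).
Implicit Types (b c : chart R T n) (X : set T).

Lemma transitionE c1 c2 p : set_inj (cdom c1) c1 -> cdom c1 p -> cdom c2 p ->
  transition c1 c2 (c1 p) = c2 p.
Proof.
move=> inj d1 d2; rewrite /transition; case: xgetP => [z _|/(_ (c2 p))[]].
  by move=> [q [dq1 dq2 /inj <-]] //; rewrite inE.
by exists p.
Qed.

(** Equality up to the meaningless values outside the domain. It is the sense in which a restricted
    chart of Y and a pulled back fibred chart coincide. *)
Definition eq_chart c c' := cdom c = cdom c' /\ forall p, cdom c p -> c p = c' p.

Lemma eq_chart_sym c c' : eq_chart c c' -> eq_chart c' c.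
Proof. by move=> [dc ec]; split=> // p dp; rewrite ec // dc. Qed.

Lemma eq_chart_transition c1 c1' c2 c2' : eq_chart c1 c1' -> eq_chart c2 c2' ->
  transition c1 c2 = transition c1' c2'.
Proof.
move=> [dc1 ec1] [dc2 ec2]; apply/funext => x; rewrite /transition; congr xget.
apply/seteqP; split=> z [p [d1 d2 <- <-]]; exists p.
  by rewrite -dc1 -dc2 ec1 ?ec2.
by rewrite -dc1 in d1; rewrite -dc2 in d2; rewrite -ec1 -?ec2.
Qed.

Lemma eq_chart_image c1 c1' c2 c2' : eq_chart c1 c1' -> eq_chart c2 c2' ->
  c1 @` (cdom c1 `&` cdom c2) = c1' @` (cdom c1' `&` cdom c2').
Proof.
move=> [dc1 ec1] [dc2 ec2]; rewrite dc1 dc2.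
by apply/seteqP; split=> z [p [d1 d2] <-]; exists p => //; rewrite ec1 // dc1.
Qed.

Lemma eq_chart_compatible c1 c1' c2 c2' : eq_chart c1 c1' -> eq_chart c2 c2' ->
  compatible c1 c2 -> compatible c1' c2'.
Proof.
move=> e1 e2; rewrite /compatible /smooth_change (eq_chart_transition e1 e2).
by rewrite (eq_chart_transition e2 e1) (eq_chart_image e1 e2) (eq_chart_image e2 e1).
Qed.

Lemma eq_chart_positively_related c1 c1' c2 c2' : eq_chart c1 c1' -> eq_chart c2 c2' ->
  positively_related c1 c2 -> positively_related c1' c2'.
Proof.
move=> e1 e2 pos p d1 d2; rewrite -(eq_chart_transition e1 e2).
case: e1 e2 => [dc1 ec1] [dc2 ec2].
by rewrite -ec1 ?dc1 //; apply: pos; rewrite ?dc1 ?dc2.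
Qed.

Lemma compatibleC c1 c2 : compatible c1 c2 -> compatible c2 c1.
Proof. by case. Qed.

Definition cinj c := set_inj (cdom c) c.

(** A change of charts factors through [b] only over the triple overlap, hence the set [W]. *)
Lemma transition_local c1 b c2 : cinj c1 -> cinj b ->
  smooth_change c1 b -> smooth_change b c2 ->
  let W := c1 @` (cdom c1 `&` cdom b `&` cdom c2) in
  [/\ open W,
      forall x, W x -> transition c1 c2 x = transition b c2 (transition c1 b x),
      forall x, W x -> (c1 @` (cdom c1 `&` cdom b)) x,
      forall x, W x -> (b @` (cdom b `&` cdom c2)) (transition c1 b x) &
      smooth_on W (transition b c2 \o transition c1 b)].
Proof.
move=> i1 ib [ o1 s1] [ o2 s2] W.
have W1 x : W x -> (c1 @` (cdom c1 `&` cdom b)) x by move=> [p [[d1 db] d2] <-]; exists p.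
have W2 x : W x -> (b @` (cdom b `&` cdom c2)) (transition c1 b x).
  by move=> [p [[d1 db] d2] <-]; rewrite transitionE //; exists p.
(* [T] carries no topology here; [W] is open as a preimage under the continuous map
   [transition c1 b]. *)
have Wo: open W.
  have -> : W = c1 @` (cdom c1 `&` cdom b) `&`
     transition c1 b @^-1` (b @` (cdom b `&` cdom c2)).
    apply/seteqP; split=> x; first by move=> Wx; split; [apply: W1|apply: W2].
    move=> [[p [d1 db] <-]] [q [dqb dq2]]; rewrite transitionE // => bqp.
    have <- : q = p by apply: ib; rewrite ?inE.
    have qp : q = p by apply: ib; rewrite ?inE.
    by exists q => //; split=> //; rewrite qp.
  by apply: open_preimage => // x; exact: smooth_continuous s1.
split=> //.
- by move=> _ [p [[d1 db] d2] <-]; rewrite !transitionE.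
- exact: smooth_comp Wo o2 W2 (smooth_sub W1 s1) s2.
Qed.

(** The intermediate chart may depend on the point: openness and smoothness are both local. *)
Lemma smooth_change_trans c1 c2 : cinj c1 ->
  (forall p, cdom c1 p -> cdom c2 p ->
     exists b, [/\ cdom b p, cinj b, smooth_change c1 b & smooth_change b c2]) ->
  smooth_change c1 c2.
Proof.
move=> i1 cov.
have loc x : (c1 @` (cdom c1 `&` cdom c2)) x -> exists W, [/\ open W, W x,
    W `<=` c1 @` (cdom c1 `&` cdom c2) & smooth_on W (transition c1 c2)].
  move=> [p [d1 d2] <-]; have [b [db ib s1 s2]] := cov p d1 d2.
  have [Wo We _ _ Ws] := transition_local i1 ib s1 s2.
  exists (c1 @` (cdom c1 `&` cdom b `&` cdom c2)); split=> //.
  - by exists p.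
  - by move=> _ [q [[? ?] ?] <-]; exists q.
  - by apply: smooth_ext Ws => // y Wy; rewrite We.
split.
  rewrite openE => x /loc[W [Wo Wx WU _]]; rewrite /interior.
  by apply: filterS WU _; exact: open_nbhs_nbhs.
by apply: smooth_local => x /loc[W [Wo Wx WU Ws]]; exists W.
Qed.

Lemma jacobian_transition c1 b c2 p : cinj c1 -> cinj b ->
  smooth_change c1 b -> smooth_change b c2 ->
  cdom c1 p -> cdom b p -> cdom c2 p ->
  jacobian (transition c1 c2) (c1 p) =
  jacobian (transition c1 b) (c1 p) *m jacobian (transition b c2) (b p).
Proof.
move=> i1 ib s1 s2 d1 db d2.
have [Wo We W1 W2 Ws] := transition_local i1 ib s1 s2.
have Wp : (c1 @` (cdom c1 `&` cdom b `&` cdom c2)) (c1 p) by exists p.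
rewrite -(@jacobian_open _ _ _ _ _ _ (c1 p) Wo Wp (fun x Wx => esym (We x Wx))).
  rewrite jacobian_comp; first by rewrite transitionE.
    by apply: smooth_differentiable s1.2 _; exact: W1.
  by apply: smooth_differentiable s2.2 _; exact: W2.
exact: smooth_differentiable Ws _.
Qed.

Lemma jacobian_transition_id c p : cinj c -> open (c @` cdom c) -> cdom c p ->
  jacobian (transition c c) (c p) = 1%:M.
Proof.
move=> ic co dp.
have cp : (c @` cdom c) (c p) by exists p.
rewrite -(jacobian_mulmx 1%:M (c p)); symmetry.
apply: jacobian_open co cp _ _.
  by move=> _ [q dq <-]; rewrite transitionE // mulmx1.
exact: differentiable_mulmx.
Qed.

Lemma jacobian_transitionV c1 c2 p : cinj c1 -> cinj c2 -> open (c1 @` cdom c1) ->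
  compatible c1 c2 -> cdom c1 p -> cdom c2 p ->
  jacobian (transition c1 c2) (c1 p) *m jacobian (transition c2 c1) (c2 p) = 1%:M.
Proof.
move=> i1 i2 o1 [s12 s21] d1 d2.
by rewrite -(jacobian_transition i1 i2 s12 s21 d1 d2 d1) jacobian_transition_id.
Qed.

(** Positivity at one point, since an intermediate chart is in general available only near that
    point. *)
Definition posdet c1 c2 p := 0 < \det (jacobian (transition c1 c2) (c1 p)).

Lemma posdet_trans c1 b c2 p : cinj c1 -> cinj b -> compatible c1 b -> compatible b c2 ->
  cdom c1 p -> cdom b p -> cdom c2 p ->
  posdet c1 b p -> posdet b c2 p -> posdet c1 c2 p.
Proof.
move=> i1 ib [s1 _] [s2 _] d1 db d2 pos1 pos2.
rewrite /posdet (jacobian_transition i1 ib s1 s2 d1 db d2) det_mulmx.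
exact: mulr_gt0 pos1 pos2.
Qed.

Lemma posdet_sym c1 c2 p : cinj c1 -> cinj c2 -> open (c1 @` cdom c1) ->
  compatible c1 c2 -> cdom c1 p -> cdom c2 p -> posdet c1 c2 p -> posdet c2 c1 p.
Proof.
move=> i1 i2 o1 co d1 d2; rewrite /posdet => pos.
have := congr1 determinant (jacobian_transitionV i1 i2 o1 co d1 d2).
rewrite det_mulmx det1 => /(congr1 (fun x => 0 < x)).
by rewrite ltr01 pmulr_rgt0.
Qed.

Lemma compatible_trans c1 c2 : cinj c1 -> cinj c2 ->
  (forall p, cdom c1 p -> cdom c2 p ->
     exists b, [/\ cdom b p, cinj b, compatible c1 b & compatible b c2]) ->
  compatible c1 c2.
Proof.
move=> i1 i2 cov; split; apply: smooth_change_trans => // p d1 d2.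
  by have [b [db ib [s1 s2] [s3 s4]]] := cov p d1 d2; exists b.
by have [b [db ib [s1 s2] [s3 s4]]] := cov p d2 d1; exists b.
Qed.

Lemma maximal_atlas_compatible X (B : set (chart R T n)) c1 c2 :
  covers X B -> (forall b, B b -> cinj b) ->
  maximal_atlas X B c1 -> maximal_atlas X B c2 -> compatible c1 c2.
Proof.
move=> cov ib [[s1 i1 _] co1] [[_ i2 _] co2].
apply: compatible_trans => // p d1 d2; have [b Bb db] := cov p (s1 p d1).
by exists b; split; [|exact: ib|exact: co1|exact/compatibleC/co2].
Qed.

End OneSet.

(** * Transport of charts along a bijection *)

Section Pullback.
Variables (T T' : Type) (n : nat) (X : set T) (X' : set T') (f : T -> T').
Hypothesis fbij : set_bij X X' f.
Implicit Types c : chart R T' n.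

Lemma pullback_inj c : cinj c -> cinj (pullback_chart X f c).
Proof.
move=> ic p q; rewrite !inE => -[Xp dp] [Xq dq] /ic; rewrite !inE => /(_ dp dq).
by case: fbij => _ fi _; apply: fi; rewrite inE.
Qed.

(** A bijection merely renames the points, so the coordinate change stays the same function;
    compatibility and determinants are inherited at once. *)
Lemma pullback_transition c1 c2 : cdom c1 `<=` X' ->
  transition (pullback_chart X f c1) (pullback_chart X f c2) = transition c1 c2.
Proof.
move=> s1; apply/funext => x; congr xget; apply/seteqP; split=> z.
  by move=> [p [[Xp d1] [_ d2] <- <-]]; exists (f p).
move=> [q [d1 d2 <- <-]]; case: fbij => _ _ /(_ q (s1 _ d1))[p Xp pq].
by exists p; split=> //=; rewrite pq.
Qed.

Lemma pullback_image c1 c2 : cdom c1 `<=` X' ->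
  pullback_chart X f c1 @` (cdom (pullback_chart X f c1) `&` cdom (pullback_chart X f c2)) =
  c1 @` (cdom c1 `&` cdom c2).
Proof.
move=> s1; apply/seteqP; split=> z.
  by move=> [p [[Xp d1] [_ d2] <-]]; exists (f p).
move=> [q [d1 d2] <-]; case: fbij => _ _ /(_ q (s1 _ d1))[p Xp pq].
by exists p; rewrite /= pq.
Qed.

Lemma pullback_compatible c1 c2 : cdom c1 `<=` X' -> cdom c2 `<=` X' ->
  compatible c1 c2 -> compatible (pullback_chart X f c1) (pullback_chart X f c2).
Proof.
move=> s1 s2; rewrite /compatible /smooth_change !pullback_transition //.
by rewrite !pullback_image.
Qed.

Lemma pullback_open c : cdom c `<=` X' -> open (c @` cdom c) ->
  open (pullback_chart X f c @` cdom (pullback_chart X f c)).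
Proof.
by move=> s1 o1; have := pullback_image c s1; rewrite !setIid => ->.
Qed.

End Pullback.

(** * Charts in which a subset is a coordinate slice *)

Section Slices.
Variables (T : Type) (n k : nat) (S : set T).
Hypothesis kn : (k <= n)%N.
Implicit Types c : chart R T n.

Definition slice c := cdom c `&` S =
  [set y | cdom c y /\ forall j : 'I_n, (k <= j)%N -> c y 0 j = 0].

Lemma sliceE c p : slice c -> cdom c p -> S p -> resize n (resize k (c p)) = c p.
Proof.
move=> sc dp Sp; apply: resizeKV => //.
have : (cdom c `&` S) p by [].
by rewrite sc => -[].
Qed.

Lemma sliceP c p (t : 'rV[R]_k) : slice c -> cdom c p -> c p = resize n t -> S p.
Proof.
move=> sc dp cp; have : (cdom c `&` S) p; last by case.
by rewrite sc; split=> // j kj; rewrite cp resize0.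
Qed.

Lemma restrict_inj c : cinj c -> slice c -> cinj (restrict_chart k S c).
Proof.
move=> ic sc p q; rewrite !inE => -[dp Sp] [dq Sq] /= e.
by apply: ic; rewrite ?inE // -(sliceE sc dp) // e sliceE.
Qed.

(** A point of the overlap lies in [S] exactly when its coordinates lie in R^k, so the image is a
    preimage under the inclusion of R^k; this is why it is open. *)
Lemma restrict_image c1 c2 : slice c1 ->
  restrict_chart k S c1 @` (cdom (restrict_chart k S c1) `&` cdom (restrict_chart k S c2)) =
  resize n @^-1` (c1 @` (cdom c1 `&` cdom c2)).
Proof.
move=> s1; apply/seteqP; split=> t.
  by move=> [p [[d1 Sp] [d2 _]] <-] /=; exists p => //; rewrite sliceE.
move=> [p [d1 d2] cp]; have Sp := sliceP s1 d1 cp.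
by exists p => //=; rewrite cp resizeK.
Qed.

Lemma restrict_open c1 c2 : slice c1 -> open (c1 @` (cdom c1 `&` cdom c2)) ->
  open (restrict_chart k S c1 @` (cdom (restrict_chart k S c1) `&` cdom (restrict_chart k S c2))).
Proof.
move=> s1 o1; rewrite restrict_image //.
by apply: open_comp => // x _; exact: resize_continuous.
Qed.

Lemma restrict_chart_on c X : chart_on X c -> slice c -> chart_on S (restrict_chart k S c).
Proof.
move=> [_ ic co] sc; split; [by move=> p []|exact: restrict_inj|].
by rewrite -[cdom _]setIid; apply: restrict_open => //; rewrite setIid.
Qed.

Lemma restrict_transition c1 c2 (t : 'rV[R]_k) : cinj c1 -> slice c1 -> slice c2 ->
  (resize n @^-1` (c1 @` (cdom c1 `&` cdom c2))) t ->
  transition c1 c2 (resize n t) =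
  resize n (transition (restrict_chart k S c1) (restrict_chart k S c2) t).
Proof.
move=> i1 s1 s2 [p [d1 d2] cp]; have Sp := sliceP s1 d1 cp.
have -> : t = restrict_chart k S c1 p by rewrite /= cp resizeK.
rewrite [RHS]/= transitionE //; last exact: restrict_inj.
by rewrite /= !sliceE // transitionE.
Qed.

Lemma restrict_smooth_change c1 c2 : cinj c1 -> slice c1 -> slice c2 ->
  smooth_change c1 c2 -> smooth_change (restrict_chart k S c1) (restrict_chart k S c2).
Proof.
move=> i1 s1 s2 [ o1 sm]; have oi := restrict_open (c2 := c2) s1 o1.
split=> //.
have := smooth_comp oi o1 _ (smooth_resize n oi) sm; rewrite {1}restrict_image //.
move=> /(_ (fun x h => h)) sm'.
have := smooth_comp oi openT (fun _ _ => I) sm' (smooth_resize k openT).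
apply: smooth_ext => // t; rewrite restrict_image // => It /=.
by rewrite restrict_transition // resizeK.
Qed.

Lemma restrict_compatible c1 c2 : cinj c1 -> cinj c2 -> slice c1 -> slice c2 ->
  compatible c1 c2 -> compatible (restrict_chart k S c1) (restrict_chart k S c2).
Proof. by move=> i1 i2 s1 s2 [sc1 sc2]; split; exact: restrict_smooth_change. Qed.

(** The chain rule applied to both sides of [restrict_transition]: the first k rows of the ambient
    Jacobian are those of the restricted change, followed by zeros. *)
Lemma restrict_jacobian c1 c2 p : cinj c1 -> slice c1 -> slice c2 ->
  smooth_change c1 c2 -> cdom c1 p -> cdom c2 p -> S p ->
  resize_mx R k n *m jacobian (transition c1 c2) (c1 p) =
  jacobian (transition (restrict_chart k S c1) (restrict_chart k S c2))
    (restrict_chart k S c1 p) *m resize_mx R k n.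
Proof.
move=> i1 s1 s2 sc d1 d2 Sp; set t := restrict_chart k S c1 p.
have [ or sr] := restrict_smooth_change i1 s1 s2 sc.
have tI : (resize n @^-1` (c1 @` (cdom c1 `&` cdom c2))) t.
  by exists p => //; rewrite sliceE.
have ctn : c1 p = t *m resize_mx R k n by rewrite -resizeE /= sliceE.
have dr : differentiable (transition (restrict_chart k S c1) (restrict_chart k S c2)) t.
  by apply: smooth_differentiable sr _; rewrite restrict_image.
have dc : differentiable (transition c1 c2) (t *m resize_mx R k n).
  by rewrite -ctn; apply: smooth_differentiable sc.2 _; exists p.
transitivity (jacobian (transition c1 c2 \o (fun x => x *m resize_mx R k n)) t).
  by rewrite (jacobian_comp (differentiable_mulmx _ t) dc) jacobian_mulmx -ctn.
transitivity (jacobian ((fun x => x *m resize_mx R k n) \o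
    transition (restrict_chart k S c1) (restrict_chart k S c2)) t); last first.
  by rewrite (jacobian_comp dr (differentiable_mulmx _ _)) jacobian_mulmx.
apply: jacobian_open or _ _ _; rewrite ?restrict_image //; last first.
  exact: (differentiable_comp (differentiable_mulmx _ t) dc).
by move=> y Iy /=; rewrite -!resizeE restrict_transition.
Qed.

End Slices.
End Charts.

(** * Fibred charts of the Grassmann fibration *)

Section Grassmann.
Variables (R : realType) (Y : Type) (m : nat) (A : set (chart R Y m)).
Hypothesis A_on : forall c, A c -> chart_on setT c.
Hypothesis A_compat : forall c c', A c -> A c' -> compatible c c'.
Variable k : nat.

Implicit Types (c : chart R Y m) (p : Y) (w : ext_power R k m) (Xi : kvector R Y m k).

Let A_inj c : A c -> cinj c. Proof. by move=> /A_on[]. Qed.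
Let A_open c : A c -> open (c @` cdom c). Proof. by move=> /A_on[]. Qed.

(* The k-vector at [p] whose components in the chart [c] are [w]. *)
Definition kv c p w : kvector R Y m k :=
  (p, fun c' => if `[< A c' /\ cdom c' p >]
                then ext_power_map (jacobian (transition c c') (c p)) w else 0).

Lemma kvE c c' p w : A c' -> cdom c' p ->
  (kv c p w).2 c' = ext_power_map (jacobian (transition c c') (c p)) w.
Proof. by move=> Ac' dp /=; rewrite asboolT. Qed.

Lemma kv_id c p w : A c -> cdom c p -> (kv c p w).2 c = w.
Proof.
move=> Ac dp; rewrite kvE // jacobian_transition_id ?ext_power_map1 //; first exact: A_inj.
exact: A_open.
Qed.

Lemma jacobianM c c' c'' p : A c -> A c' -> A c'' -> cdom c p -> cdom c' p -> cdom c'' p ->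
  jacobian (transition c c') (c p) *m jacobian (transition c' c'') (c' p) =
  jacobian (transition c c'') (c p).
Proof.
move=> Ac Ac' Ac'' d d' d''; symmetry.
have [s _] := A_compat Ac Ac'; have [s' _] := A_compat Ac' Ac''.
exact: jacobian_transition (A_inj Ac) (A_inj Ac') s s' d d' d''.
Qed.

(** The transformation rule is the cocycle identity [jacobianM] pushed through the functoriality of
    Lambda^k. *)
Lemma kv_kvectors c p w : A c -> cdom c p -> kvectors A k (kv c p w).
Proof.
move=> Ac dp; split=> [c' c'' Ac' Ac'' d' d''|c' nc'].
  apply: etrans (kvE c w Ac'' d'') _.
  rewrite -(jacobianM Ac Ac' Ac'' dp d' d'') -ext_power_mapM.
  congr ext_power_map; exact: esym (kvE c w Ac' d').
by rewrite /= asboolF.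
Qed.

(** The transformation rule fixes the components in charts at the base point, and the convention 0
    fixes all others, so one chart determines the whole pair. *)
Lemma kvectorsE Xi c : kvectors A k Xi -> A c -> cdom c Xi.1 -> Xi = kv c Xi.1 (Xi.2 c).
Proof.
case: Xi => p v [/= tr nv] Ac dc; congr pair; apply/funext => c' /=.
by case: asboolP => [[Ac' dc']|/nv //]; rewrite (tr c c').
Qed.

Lemma kv_change c c' p w : A c -> A c' -> cdom c p -> cdom c' p ->
  kv c p w = kv c' p (ext_power_map (jacobian (transition c c') (c p)) w).
Proof.
move=> Ac Ac' d d'; rewrite [LHS](kvectorsE (kv_kvectors w Ac d) Ac' d').
by rewrite [X in kv _ _ X]kvE.
Qed.

Lemma kv_nonzero c p w : A c -> cdom c p -> w <> 0 -> nonzero_kvectors A k (kv c p w).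
Proof.
by move=> Ac dp w0; split; [exact: kv_kvectors|exists c; rewrite kv_id].
Qed.

Lemma kvector_equiv_refl Xi : kvector_equiv Xi Xi.
Proof. by split=> //; exists 1 => [//|c]; rewrite scale1r. Qed.

Lemma kvector_equiv_sym Xi Xi' : kvector_equiv Xi Xi' -> kvector_equiv Xi' Xi.
Proof.
move=> [e [l l0 le]]; split=> //; exists l^-1; rewrite ?invr_gt0 // => c.
by rewrite le scalerA mulVf ?scale1r // gt_eqF.
Qed.

Lemma kvector_equiv_trans Xi Xi' Xi'' :
  kvector_equiv Xi Xi' -> kvector_equiv Xi' Xi'' -> kvector_equiv Xi Xi''.
Proof.
move=> [e [l l0 le]] [e' [l' l0' le']]; split; first by rewrite e.
by exists (l * l'); rewrite ?mulr_gt0 // => c; rewrite le le' scalerA.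
Qed.

Lemma kappa_eq Xi Xi' : kvector_equiv Xi Xi' -> kappa A Xi = kappa A Xi'.
Proof.
move=> e; apply/seteqP; split=> Z [nZ Ze]; split=> //.
  exact: kvector_equiv_trans Ze e.
exact: kvector_equiv_trans Ze (kvector_equiv_sym e).
Qed.

Lemma kappa_inj Xi Xi' : nonzero_kvectors A k Xi -> kappa A Xi = kappa A Xi' ->
  kvector_equiv Xi Xi'.
Proof.
move=> nXi e; have : kappa A Xi Xi by split=> //; exact: kvector_equiv_refl.
by rewrite e => -[].
Qed.

Definition cls c p w : set (kvector R Y m k) := kappa A (kv c p w).

Lemma cls_scale c p w (l : R) : 0 < l -> cls c p (l *: w) = cls c p w.
Proof.
move=> l0; apply: kappa_eq; split=> //; exists l => // c' /=.
by case: ifP => _; rewrite ?scaler0 // ext_power_mapZ.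
Qed.

Lemma cls_change c c' p w : A c -> A c' -> cdom c p -> cdom c' p ->
  cls c p w = cls c' p (ext_power_map (jacobian (transition c c') (c p)) w).
Proof. by move=> Ac Ac' d d'; rewrite /cls (kv_change w Ac Ac' d d'). Qed.

Lemma cls_base c c' p p' w w' : A c -> cdom c p -> w <> 0 ->
  cls c p w = cls c' p' w' -> p = p'.
Proof. by move=> Ac d w0 /(kappa_inj (kv_nonzero Ac d w0))[]. Qed.

Lemma cls_grassmann c p w : A c -> cdom c p -> w <> 0 -> grassmann A k (cls c p w).
Proof. by move=> Ac d w0; exists (kv c p w) => //; exact: kv_nonzero. Qed.

Section FibredCharts.
Variable nu : multiindex k m.

Let N := #|{: multiindex k m}|.

Definition fibred_encode (x : 'rV[R]_m) w : 'rV[R]_(grassmann_dim m k) :=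
  row_mx x (\row_(j < N.-1) w (enum_val (lift (enum_rank nu) j))).

(** Restores the component 1 at [nu] that the coordinates omit: a class with positive component at
    [nu] has exactly one representative normalised in this way. *)
Definition fibred_decode (x : 'rV[R]_(grassmann_dim m k)) : ext_power R k m :=
  [ffun I => if unlift (enum_rank nu) (enum_rank I) is Some j
             then (rsubmx x : 'rV[R]_(N.-1)) 0 j else 1].

Lemma fibred_decode1 x : fibred_decode x nu = 1.
Proof. by rewrite ffunE unlift_none. Qed.

Lemma neq0_nu w : w nu = 1 -> w <> 0.
Proof. by move=> w1 w0; have := oner_neq0 R; rewrite -w1 w0 ffunE eqxx. Qed.

Lemma fibred_encodeL x w : lsubmx (fibred_encode x w) = x.
Proof. exact: row_mxKl. Qed.

Lemma fibred_decodeK x : fibred_encode (lsubmx x) (fibred_decode x) = x.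
Proof.
rewrite /fibred_encode -[RHS]hsubmxK; congr row_mx; apply/rowP => j.
by rewrite mxE ffunE enum_valK liftK.
Qed.

Lemma fibred_encodeK x w : w nu = 1 -> fibred_decode (fibred_encode x w) = w.
Proof.
move=> w1; apply/ffunP => I; rewrite ffunE; case: unliftP => [j e|e].
  by rewrite row_mxKr mxE -e enum_rankK.
by rewrite -w1; congr (w _); exact: enum_rank_inj.
Qed.

(** Dividing by the positive component at [nu] does not leave the class, whence the normalised
    representative. *)
Lemma fibred_domP c X : A c -> cdom (fibred_chart A c nu) X <->
  exists p w, [/\ cdom c p, w nu = 1 & X = cls c p w].
Proof.
move=> Ac; split=> [[Xi [nXi dc pos] <-]|[p [w [dp w1 ->]]]].
  exists Xi.1, ((Xi.2 c nu)^-1 *: Xi.2 c); split=> //.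
    by rewrite ffunE /= [LHS]mulVf // gt_eqF.
  rewrite cls_scale ?invr_gt0 //; congr kappa; case: nXi => kXi _.
  exact: kvectorsE.
exists (kv c p w) => //; split=> //; first exact: kv_nonzero (neq0_nu w1).
by rewrite kv_id // w1.
Qed.

Lemma fibredE c p w : A c -> cdom c p -> 0 < w nu ->
  fibred_chart A c nu (cls c p w) = fibred_encode (c p) ((w nu)^-1 *: w).
Proof.
move=> Ac dp w0; have nz : w <> 0 by move=> z; move: w0; rewrite z ffunE ltxx.
have E : fibred_coordinates c nu (kv c p w) = fibred_encode (c p) ((w nu)^-1 *: w).
  rewrite /fibred_coordinates kv_id //; congr row_mx.
  by apply/rowP => j; rewrite !mxE ffunE [RHS]mulrC.
(* The representative picked by [xget] differs from [kv c p w] by a factor l, which cancels in the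
   quotients; the other branch is excluded because the class contains [kv c p w]. *)
rewrite -E /=; case: xgetP => [x _ [Xi [nXi [e [l l0 le]]] <-]|/(_ _)].
  rewrite /fibred_coordinates e !le; congr row_mx; apply/rowP => j; rewrite !mxE.
  rewrite !ffunE kv_id //= -[l *: _]/(l * _) -[l *: _]/(l * _) invfM mulrACA.
  by rewrite mulfV ?gt_eqF // mul1r.
move=> /(_ (fibred_coordinates c nu (kv c p w)))[]; exists (kv c p w) => //.
by split; [exact: kv_nonzero|exact: kvector_equiv_refl].
Qed.

Lemma fibredE1 c p w : A c -> cdom c p -> w nu = 1 ->
  fibred_chart A c nu (cls c p w) = fibred_encode (c p) w.
Proof. by move=> Ac dp w1; rewrite fibredE ?w1 // invr1 scale1r. Qed.

Lemma fibred_decodeE c p x : A c -> cdom c p -> c p = lsubmx x ->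
  fibred_chart A c nu (cls c p (fibred_decode x)) = x.
Proof. by move=> Ac dp cp; rewrite fibredE1 ?fibred_decode1 // cp fibred_decodeK. Qed.

(** The fibre coordinates are unconstrained, so the image is the full cylinder over the range of
    [c]. *)
Lemma fibred_image c : A c ->
  fibred_chart A c nu @` cdom (fibred_chart A c nu) = lsubmx @^-1` (c @` cdom c).
Proof.
move=> Ac; apply/seteqP; split=> x.
  move=> [_ /(fibred_domP _ Ac)[p [w [dp w1 ->]]] <-].
  by rewrite fibredE1 //= row_mxKl; exists p.
move=> [p dp cp]; exists (cls c p (fibred_decode x)).
  by apply/fibred_domP => //; exists p, (fibred_decode x); rewrite fibred_decode1.
by rewrite fibredE1 ?fibred_decode1 // cp fibred_decodeK.
Qed.

Lemma fibred_inj c : A c -> cinj (fibred_chart A c nu).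
Proof.
move=> Ac X X'; rewrite !inE => /(fibred_domP _ Ac)[p [w [dp w1 ->]]].
move=> /(fibred_domP _ Ac)[p' [w' [dp' w1' ->]]] e.
have {}e := etrans (esym (fibredE1 Ac dp w1)) (etrans e (fibredE1 Ac dp' w1')).
have cpp : c p = c p' by have := congr1 lsubmx e; rewrite !row_mxKl.
have -> : p = p' by apply: (A_inj Ac); rewrite ?inE.
by rewrite -(fibred_encodeK (c p) w1) e fibred_encodeK.
Qed.

End FibredCharts.

(** * Coordinate changes between fibred charts *)

Section FibredTransition.
Variables (c c' : chart R Y m) (nu nu' : multiindex k m).
Hypotheses (Ac : A c) (Ac' : A c').

Let N := #|{: multiindex k m}|.
Let D := c @` (cdom c `&` cdom c').
(** The components in [c'] of the normalised representative with coordinates [x]. The overlap of the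
    two charts is where the component at [nu'] is positive, and renormalising there gives the
    coordinate change [G]. *)
Let W (x : 'rV[R]_(grassmann_dim m k)) : ext_power R k m :=
  ext_power_map (jacobian (transition c c') (lsubmx x)) (fibred_decode nu x).
Let V : set 'rV[R]_(grassmann_dim m k) := lsubmx @^-1` D.
Let U := V `&` [set x | 0 < W x nu'].
Let G (x : 'rV[R]_(grassmann_dim m k)) :=
  fibred_encode nu' (transition c c' (lsubmx x)) ((W x nu')^-1 *: W x).

Let D_open : open D. Proof. by have [[]] := A_compat Ac Ac'. Qed.

Let D_smooth : smooth_on D (transition c c').
Proof. by have [[]] := A_compat Ac Ac'. Qed.

Lemma smooth_lsubmx (n1 n2 : nat) (B : set 'rV[R]_(n1 + n2)) : open B ->
  smooth_on B lsubmx.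
Proof.
move=> Bo; apply/smooth_onP => // i r.
by under eq_fun do rewrite mxE; exact: Ck_coord_fun.
Qed.

Let V_open : open V.
Proof.
apply: open_comp => // x _; exact: smooth_continuous (smooth_lsubmx openT) I.
Qed.

Let W_smooth I r : Ck r V (fun x => W x I).
Proof.
rewrite /W; under eq_fun do rewrite ffunE.
apply: Ck_sum => // J _; apply: CkM => //.
  under eq_fun do rewrite ffunE.
  case: unlift => [j|]; last exact: Ck_cst.
  by under eq_fun do rewrite mxE; exact: Ck_coord_fun.
apply: Ck_det => // i j; under eq_fun do rewrite mxE.
apply: (Ck_comp (f := lsubmx) (g := fun y => jacobian (transition c c') y _ _) V_open D_open) => //.
  by apply/Cr_onE; exact: smooth_lsubmx.
by apply: Ck_diff_entry => //; apply/Cr_onE; exact: D_smooth.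
Qed.

Let U_open : open U.
Proof.
apply: (@open_preimage _ _ V [set t : R | 0 < t] (fun x => W x nu') V_open).
  exact: (W_smooth nu' 0).
exact: open_gt.
Qed.

Let G_smooth : smooth_on U G.
Proof.
apply/smooth_onP => // i r; rewrite /G /fibred_encode.
have UV : U `<=` V by move=> x [].
case: (split_ordP i) => j ->.
  under eq_fun do rewrite row_mxEl.
  apply: (Ck_comp (f := lsubmx) (g := fun y => transition c c' y 0 j) U_open D_open).
  - by move=> x [].
  - by apply/Cr_onE; exact: smooth_lsubmx.
  - by move: j r; apply/smooth_onP.
under eq_fun do rewrite row_mxEr mxE ffunE.
apply: CkM => //; last exact: Ck_sub UV _.
by apply: CkV => // [x [_ /= /gt_eqF->]//|]; exact: Ck_sub UV _.
Qed.

Let fibred_change_image :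
  fibred_chart A c nu @` (cdom (fibred_chart A c nu) `&` cdom (fibred_chart A c' nu')) = U.
Proof.
apply/seteqP; split=> x.
  move=> [_ [/(fibred_domP _ _ Ac)[p [w [dp w1 ->]]]]].
  move=> /(fibred_domP _ _ Ac')[p' [w' [dp' w1' e]]] <-.
  have pp' : p = p' by apply: cls_base e => //; exact: neq0_nu w1.
  rewrite -pp' {p' pp'} in dp' e.
  rewrite (fibredE1 Ac dp w1); split.
    have Dp : D (c p) by exact: (ex_intro2 _ _ p (conj dp dp') erefl).
    rewrite -(fibred_encodeL nu (c p) w) in Dp.
    exact: Dp.
  pose W0 := ext_power_map (jacobian (transition c c') (c p)) w.
  have WE : W (fibred_encode nu (c p) w) = W0.
    by rewrite /W (fibred_encodeK (c p) w1) fibred_encodeL.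
  suff : 0 < W0 nu' by rewrite -WE.
  rewrite (cls_change w Ac Ac' dp dp') -/W0 in e.
  (* Both representatives are now read in [c'], so w' = l W0 with l > 0; evaluating at [nu'], where
     w' is 1, makes W0 positive. *)
  have [_ [l l0 le]] := kappa_inj (kv_nonzero Ac' dp' (neq0_nu w1')) (esym e).
  have := le c'; rewrite (kv_id _ Ac' dp') (kv_id _ Ac' dp') => /ffunP/(_ nu').
  rewrite w1' [RHS]ffunE => le'; have : 0 < l * W0 nu' by rewrite -[l * _]le'; exact: ltr01.
  by rewrite pmulr_rgt0.
move=> [[p [dp dp'] cp] Wx]; pose w := fibred_decode nu x.
have w1 : w nu = 1 by exact: fibred_decode1.
have {}Wx : 0 < W x nu' by exact: Wx.
exists (cls c p w); last exact: fibred_decodeE.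
split; first by apply/(fibred_domP nu _ Ac); exists p, w.
apply/(fibred_domP nu' _ Ac'); exists p, ((W x nu')^-1 *: W x).
split; first exact: dp'.
  by rewrite ffunE; apply: mulVf; rewrite gt_eqF.
have l0 : 0 < (W x nu')^-1 by rewrite invr_gt0.
by rewrite (cls_scale _ _ _ l0) (cls_change w Ac Ac' dp dp') cp.
Qed.

Let fibred_change_transition x : U x ->
  transition (fibred_chart A c nu) (fibred_chart A c' nu') x = G x.
Proof.
move=> [[p [dp dp'] cp] Wx]; pose w := fibred_decode nu x.
have w1 : w nu = 1 by exact: fibred_decode1.
have Ex : fibred_chart A c nu (cls c p w) = x.
  exact: fibred_decodeE.
have Ux : U x by split => //; exists p.
have := Ux; rewrite -fibred_change_image => -[X [dX dX'] eX].
have XE : X = cls c p w.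
  apply: (fibred_inj (nu := nu) Ac); rewrite ?inE // ?eX ?Ex //.
  by apply/(fibred_domP nu _ Ac); exists p, w.
rewrite -[in LHS]eX transitionE //; last exact: fibred_inj.
rewrite XE (cls_change w Ac Ac' dp dp') cp (fibredE Ac' dp' Wx) /G -/(W x).
by rewrite -[in RHS]cp transitionE //; exact: A_inj.
Qed.

Lemma fibred_smooth_change : smooth_change (fibred_chart A c nu) (fibred_chart A c' nu').
Proof.
rewrite /smooth_change fibred_change_image; split=> //.
by apply: smooth_ext G_smooth => // x Ux; rewrite fibred_change_transition.
Qed.

End FibredTransition.

Lemma fibred_grassmann_atlas c nu : A c -> grassmann_atlas A k (fibred_chart A c nu).
Proof.
move=> Ac; split; first split.
- move=> _ /(fibred_domP _ _ Ac)[p [w [dp w1 ->]]].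
  by apply: cls_grassmann => //; exact: neq0_nu w1.
- exact: fibred_inj.
- rewrite fibred_image //; apply: open_comp; last exact: A_open.
  by move=> x _; exact: smooth_continuous (smooth_lsubmx openT) I.
- by move=> _ [c' [nu' [Ac' ->]]]; split; exact: fibred_smooth_change.
Qed.

End Grassmann.

(** * Submanifolds and changes of coordinates *)

Section Submanifolds.
Variables (R : realType) (T : Type) (n k : nat) (X S : set T) (A : set (chart R T n)).
Hypotheses (kn : (k <= n)%N) (A_on : forall c, A c -> chart_on X c)
  (A_sub : submanifold A k S).

Lemma adapted_slice c : adapted A k S c -> slice k S c.
Proof. by case. Qed.

Lemma adapted_inj c : adapted A k S c -> cinj c.
Proof. by case=> /A_on[]. Qed.

Lemma submanifold_atlas_compatible c1 c2 :
  submanifold_atlas A k S c1 -> submanifold_atlas A k S c2 -> compatible c1 c2.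
Proof.
apply: maximal_atlas_compatible.
  move=> p Sp; have [c ac dp] := A_sub Sp.
  by exists (restrict_chart k S c) => //; exists c.
move=> _ [c ac <-]; apply: restrict_inj => //; first exact: adapted_inj.
exact: adapted_slice.
Qed.

(** Compatibility is asked of the single chart [c]. For a generating fibred chart it comes directly
    from the definition of [maximal_atlas]. *)
Lemma restrict_submanifold_atlas c : adapted A k S c ->
  (forall c', adapted A k S c' -> compatible c c') ->
  submanifold_atlas A k S (restrict_chart k S c).
Proof.
move=> ac co; split.
  by apply: restrict_chart_on (A_on ac.1) _ => //; exact: adapted_slice.
move=> _ [c' ac' <-]; apply: restrict_compatible (co c' ac') => //;
  by [exact: adapted_inj|exact: adapted_slice].
Qed.

End Submanifolds.

(** * Shrinking a chart and changing its coordinates linearly *)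

Section ChangeOfCoordinates.
Variables (R : realType) (T : Type) (m : nat) (A : set (chart R T m)).
Hypothesis A_max : A = maximal_atlas setT A.

Lemma maximal_on c : A c -> chart_on setT c.
Proof. by rewrite A_max => -[]. Qed.

Lemma maximal_compatible c c' : A c -> A c' -> compatible c c'.
Proof. by rewrite {1}A_max => -[_ co] /co. Qed.

Definition recoordinate (c : chart R T m) (V : set 'rV[R]_m) (M : 'M[R]_m) :=
  Chart (cdom c `&` c @^-1` V) (fun p => c p *m M).

(** Since [M] is its own inverse, images under multiplication by [M] are preimages under the same
    continuous map, hence open. *)
Lemma recoordinate_maximal c V M : A c -> open V -> M *m M = 1%:M ->
  A (recoordinate c V M).
Proof.
move=> Ac Vo MM; have MK (x : 'rV[R]_m) : x *m M *m M = x by rewrite -mulmxA MM mulmx1.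
have [_ ic co] := maximal_on Ac.
have ir : cinj (recoordinate c V M).
  move=> p q; rewrite !inE => -[dp _] [dq _] /= e.
  by apply: ic; rewrite ?inE // -[LHS]MK e MK.
have Mc : continuous (fun x : 'rV[R]_m => x *m M).
  by move=> x; exact: smooth_continuous (smooth_mulmx M openT) I.
have im (D : set T) : recoordinate c V M @` (cdom (recoordinate c V M) `&` D) =
    (fun x => x *m M) @^-1` (c @` (cdom c `&` D) `&` V).
  apply/seteqP; split=> x.
    move=> [p [[dp Vp] Dp] <-]; rewrite /preimage /= MK; split=> //.
    by exists p.
  move=> [[p [dp Dp] cp] Vx]; exists p; first by do !split => //=; rewrite cp.
  by rewrite /= cp MK.
rewrite A_max; split.
  split=> //; rewrite -[cdom _]setIT im setIT.
  by apply: open_comp; [move=> x _; exact: Mc|exact: openI].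
move=> b Ab; have [_ ib _] := maximal_on Ab; have [[ o1 s1] [ o2 s2]] := maximal_compatible Ac Ab.
split.
  rewrite /smooth_change im.
  have Io : open ((fun x : 'rV[R]_m => x *m M) @^-1` (c @` (cdom c `&` cdom b) `&` V)).
    by apply: open_comp; [move=> x _; exact: Mc|exact: openI].
  split=> //; apply: smooth_ext Io _ (smooth_comp Io o1 _ (smooth_mulmx M Io) s1).
    move=> x; rewrite -im => -[p [[dp Vp] db] <-].
    by rewrite transitionE //= MK transitionE.
  by move=> x [].
have ib' : b @` (cdom b `&` cdom (recoordinate c V M)) =
    b @` (cdom b `&` cdom c) `&` transition b c @^-1` V.
  apply/seteqP; split=> x.
    by move=> [p [db [dc Vp]] <-]; split; [exists p|rewrite /= transitionE].
  by move=> [[p [db dc] <-]]; rewrite /= transitionE // => Vp; exists p.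
have Io : open (b @` (cdom b `&` cdom (recoordinate c V M))).
  rewrite ib'; apply: open_preimage o2 _ Vo => x; exact: smooth_continuous s2.
split=> //.
have sb : smooth_on (b @` (cdom b `&` cdom (recoordinate c V M))) (transition b c).
  by apply: smooth_sub s2; rewrite ib' => x [].
apply: smooth_ext Io _ (smooth_comp Io openT (fun _ _ => I) sb (smooth_mulmx M openT)).
by move=> _ [p [db dc] <-] /=; rewrite !transitionE //; case: dc.
Qed.

End ChangeOfCoordinates.

(** * Sign changes of the first coordinate *)

Section Reflections.
Variables (R : realType) (s : R).
Hypothesis ss : s * s = 1.

Definition reflection n : 'M[R]_n := diag_mx (\row_(j < n) if val j == 0%N then s else 1).

Lemma mulmx_reflection n (x : 'rV[R]_n) j :
  (x *m reflection n) 0 j = x 0 j * (if val j == 0%N then s else 1).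
Proof. by rewrite mul_mx_diag !mxE. Qed.

Lemma reflectionK n : reflection n *m reflection n = 1%:M.
Proof.
rewrite mul_diag_mx; apply/matrixP => i j; rewrite !mxE.
by case: (eqVneq i j) => [->|_] /=; [case: ifP; rewrite ?mulr1n ?ss ?mulr1|rewrite !mulr0n mulr0].
Qed.

Lemma det_reflection n : (0 < n)%N -> \det (reflection n) = s.
Proof.
case: n => // n _; rewrite det_diag big_ord_recl mxE /= big1 ?mulr1 // => i _.
by rewrite mxE.
Qed.

(** The scaled coordinate has index 0 in every dimension, so a reflection of the ambient chart
    restricts to a reflection of the chart of S. *)
Lemma resize_reflection n p (x : 'rV[R]_n) :
  resize p (x *m reflection n) = resize p x *m reflection p.
Proof.
apply/rowP => j; rewrite mulmx_reflection !mxE.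
case: insubP => [i _ ij|_] /=; last by rewrite mul0r.
by move: ij => /= ij; rewrite mulmx_reflection /= ij.
Qed.

End Reflections.

(** * The Grassmann lift of an oriented submanifold *)

Lemma det_neq0_mulmx1 (R : idomainType) n (M N : 'M[R]_n) : M *m N = 1%:M -> \det M != 0.
Proof.
move=> /(congr1 determinant); rewrite det_mulmx det1 => e; apply/eqP => z.
by move/eqP: e; rewrite z mul0r eq_sym oner_eq0.
Qed.

Lemma resize_row_mx (R : realType) n p k (x : 'rV[R]_n) (y : 'rV[R]_p) :
  (k <= n)%N -> resize k (row_mx x y) = resize k x.
Proof.
move=> kn; apply/rowP => j; have jn : (j < n)%N := leq_trans (ltn_ord j) kn.
rewrite !mxE (insubT (ltn^~ n) jn) (insubT (ltn^~ (n + p)%N) (leq_trans jn (leq_addr p n))) /=.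
rewrite -(row_mxEl x y); congr (row_mx x y 0 _); exact: val_inj.
Qed.

Section Oriented.
Variables (R : realType) (Y : topologicalType) (m k : nat).
Variables (A : set (chart R Y m)) (S : set Y) (O : set (chart R Y k)).
Hypotheses (A_max : A = maximal_atlas setT A) (k_gt0 : (0 < k)%N) (km : (k <= m)%N).
Hypotheses (A_sub : submanifold A k S).
Hypothesis O_ori : orientation S (submanifold_atlas A k S) O.

Let A_on := maximal_on A_max.
Let A_compat := maximal_compatible A_max.
Let AS := submanifold_atlas A k S.

Let A_inj c : A c -> cinj c. Proof. by move=> /A_on[]. Qed.

Let AS_compat c1 c2 : AS c1 -> AS c2 -> compatible c1 c2.
Proof. exact: (submanifold_atlas_compatible km A_on A_sub). Qed.

Let O_AS o : O o -> AS o.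
Proof. by case: O_ori => _ {1}-> []. Qed.

Let O_pos o o' : O o -> O o' -> positively_related o o'.
Proof. by case: O_ori => _ {1}-> [_ h] /h. Qed.

Let AS_inj c : AS c -> cinj c. Proof. by case=> -[]. Qed.

Let AS_open c : AS c -> open (c @` cdom c). Proof. by case=> -[]. Qed.

Let restrict_AS c : adapted A k S c -> AS (restrict_chart k S c).
Proof.
move=> ac; apply: (restrict_submanifold_atlas km A_on ac) => c' ac'.
exact: A_compat ac.1 ac'.1.
Qed.

Definition oriented_adapted c := adapted A k S c /\ O (restrict_chart k S c).

(* An adapted chart is made positively oriented by shrinking its domain to where
   its Jacobian determinant against a positive chart has constant sign [s] and
   multiplying the first coordinate by [s]. *)
Lemma oriented_adapted_exists y : S y -> exists2 c, oriented_adapted c & cdom c y.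
Proof.
move=> Sy; have [c0 ac0 d0y] := A_sub Sy; have [ o Oo doy] := O_ori.1 y Sy.
pose r0 := restrict_chart k S c0.
have [Ac0 sl0] : A c0 /\ slice k S c0 by [].
have ASr0 : AS r0 by exact: restrict_AS.
have co := AS_compat ASr0 (O_AS Oo).
have [ir0 io] := (AS_inj ASr0, AS_inj (O_AS Oo)).
pose W := r0 @` (cdom r0 `&` cdom o).
have [[Wo Ws] _] := co.
pose d t := \det (jacobian (transition r0 o) t).
have Cd : Ck 0 W d.
  by apply: Ck_det => // i j; apply: Ck_diff_entry => //; apply/Cr_onE; exact: Ws.
pose s := Num.sg (d (r0 y)).
have dy0 : d (r0 y) != 0.
  exact: det_neq0_mulmx1 (jacobian_transitionV ir0 io (AS_open ASr0) co (conj d0y Sy) doy).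
have ss : s * s = 1 by rewrite -expr2 sqr_sg dy0.
have sdy : 0 < s * d (r0 y) by rewrite /s -normrEsg normr_gt0.
pose V := W `&` [set t | 0 < s * d t].
have Vo : open V.
  apply: (@open_preimage _ _ W [set t : R | 0 < t] (fun t => s * d t) Wo).
    by move=> t Wt; exact: cvgM (@cvg_cst _ s _ _ _) (Cd t Wt).
  exact: open_gt.
pose V' := resize k @^-1` V : set 'rV[R]_m.
have V'o : open V' by apply: open_comp => // x _; exact: resize_continuous.
pose c := recoordinate c0 V' (reflection s m).
have Ac : A c by apply: recoordinate_maximal => //; exact: reflectionK.
have ac : adapted A k S c.
  split=> //; apply/seteqP; split=> p.
    move=> [[d0p Vp] Sp]; split=> // j kj; rewrite mulmx_reflection.
    have : (cdom c0 `&` S) p by [].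
    by rewrite sl0 => -[_ ->]; rewrite ?mul0r.
  move=> [[d0p Vp] z]; split=> //.
  suff : (cdom c0 `&` S) p by case.
  (* The vanishing coordinates have index at least k > 0, so the reflection leaves them alone. *)
  rewrite sl0; split=> // j kj; have := z j kj; rewrite mulmx_reflection.
  by rewrite (gtn_eqF (leq_trans k_gt0 kj)) mulr1.
exists c; last first.
  split=> //; split; first by exists y.
  exact: sdy.
split=> //; set r := restrict_chart k S c.
have ASr : AS r by exact: restrict_AS.
have rr0 p : cdom r p -> r p *m reflection s k = r0 p.
  move=> _; rewrite /= resize_reflection -mulmxA reflectionK // mulmx1 //.
case: O_ori => _ ->; split=> // o' Oo' p [[d0p [[q [[d0q Sq] doq] rq] pos]] Sp] do'p.
have qp : q = p by apply: ir0; rewrite ?inE.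
rewrite qp in doq.
have dr0p : cdom r0 p by [].
have drp : cdom r p by split=> //; split=> //; split=> //; exists q; rewrite ?qp.
have cr := AS_compat ASr ASr0.
have ir := AS_inj ASr.
apply: (posdet_trans ir io (AS_compat ASr (O_AS Oo)) (AS_compat (O_AS Oo) (O_AS Oo'))
  drp doq do'p); last exact: O_pos.
(* Through [r0] the determinant against [o] factors as s times d, which is positive on [V] by
   construction. *)
rewrite /posdet (jacobian_transition ir ir0 cr.1 co.1 drp dr0p doq) det_mulmx.
have -> : jacobian (transition r r0) (r p) = reflection s k.
  rewrite -[RHS](jacobian_mulmx _ (r p)).
  have Ir : (r @` (cdom r `&` cdom r0)) (r p) by exists p.
  apply: (jacobian_open cr.1.1 Ir).
    move=> _ [z [drz dr0z] <-]; rewrite (transitionE ir drz dr0z).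
    exact: esym (rr0 _ drz).
  exact: smooth_differentiable cr.1.2 Ir.
rewrite det_reflection //; exact: pos.
Qed.

(** The k-vector d/dy^1 /\ ... /\ d/dy^k, written as an image under the inclusion of R^k so that
    functoriality applies to it directly. *)
Definition unit_kvector : ext_power R k m := ext_power_map (resize_mx R k m) (std_kvector R k).

Lemma multiindex_first_subproof :
  sorted (fun i j : 'I_m => (i < j)%N) [tuple widen_ord km i | i < k].
Proof.
have -> : [tuple widen_ord km i | i < k] = map (widen_ord km) (ord_tuple k) :> seq _ by [].
by rewrite sorted_map; exact: multiindex_full_subproof.
Qed.

Definition multiindex_first : multiindex k m :=
  exist _ [tuple widen_ord km i | i < k] multiindex_first_subproof.

Lemma unit_kvectorE J : unit_kvector J = (multiindex_first == J)%:R.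
Proof.
rewrite /unit_kvector ext_power_map_std -minor1; congr determinant.
by apply/matrixP => i j; rewrite !mxE tnth_mktuple.
Qed.

Lemma unit_kvector1 : unit_kvector multiindex_first = 1.
Proof. by rewrite unit_kvectorE eqxx. Qed.

Lemma unit_kvector_neq0 : unit_kvector <> 0.
Proof. exact: neq0_nu unit_kvector1. Qed.

(** Read in a chart [c'], the map being lifted is the transition from [c] preceded by the inclusion
    of R^k; the chain rule and functoriality split off the unit k-vector. *)
Lemma grassmann_liftE c y : adapted A k S c -> cdom c y -> S y ->
  grassmann_lift A c y (resize k (c y)) = cls A c y unit_kvector.
Proof.
move=> [Ac sl] dy Sy; have ic := A_inj Ac.
have inv p : cdom c p -> chart_inv c y (c p) = p.
  move=> dp; rewrite /chart_inv; case: xgetP => [q _ [dq cqp]|/(_ p)/not_andP[]//].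
  by apply: ic; rewrite ?inE.
have cy : resize m (resize k (c y)) = c y by exact: (sliceE km sl dy Sy).
congr kappa; rewrite /canonical_lift /kv cy inv //; congr pair.
apply/funext => c'; case: ifPn => // /asboolP[Ac' d'y].
rewrite ext_power_mapM; congr ext_power_map.
have [[ o1 s1] _] := A_compat Ac Ac'.
set t := resize k (c y).
have tE : t *m resize_mx R k m = c y by rewrite -resizeE.
pose U := resize m @^-1` (c @` (cdom c `&` cdom c')) : set 'rV[R]_k.
have Uo : open U by apply: open_comp => // x _; exact: resize_continuous.
have Ut : U t by exists y => //; rewrite cy.
have dt : differentiable (transition c c') (t *m resize_mx R k m).
  by rewrite tE; apply: smooth_differentiable s1 _; exists y.
transitivity (jacobian (transition c c' \o (fun s => s *m resize_mx R k m)) t).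
  (* The two maps agree only on [U], since [chart_inv] and [transition] have unrelated default
     values outside the charts. *)
  symmetry; apply: jacobian_open Uo Ut _ _.
    move=> s [p [dp d'p] cp]; rewrite /= -resizeE -cp transitionE //.
    by rewrite inv.
  exact: differentiable_comp (differentiable_mulmx _ t) dt.
by rewrite (jacobian_comp (differentiable_mulmx _ t) dt) jacobian_mulmx tE.
Qed.

(* The Jacobian of a change of adapted charts is block triangular at the points of
   [S], so it multiplies the unit k-vector by the determinant of its block. *)
Lemma cls_unique c c' y : oriented_adapted c -> oriented_adapted c' ->
  cdom c y -> cdom c' y -> S y -> cls A c y unit_kvector = cls A c' y unit_kvector.
Proof.
move=> [[Ac sl] Oc] [[Ac' sl'] Oc'] dy d'y Sy.
have [s1 _] := A_compat Ac Ac'.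
rewrite (cls_change A_on A_compat _ Ac Ac' dy d'y) ext_power_mapM.
rewrite (restrict_jacobian km (A_inj Ac) sl sl' s1 dy d'y Sy) -ext_power_mapM.
rewrite ext_power_map_std_det ext_power_mapZ cls_scale //.
by apply: (O_pos Oc Oc').
Qed.

(** On [S] a suitable chart exists and [cls_unique] makes the choice of [xget] immaterial; elsewhere
    the value is irrelevant. *)
Definition grassmann_section (y : Y) : set (kvector R Y m k) :=
  xget set0 [set X | exists c, [/\ oriented_adapted c, cdom c y & X = cls A c y unit_kvector]].

Lemma grassmann_sectionE c y : oriented_adapted c -> cdom c y -> S y ->
  grassmann_section y = cls A c y unit_kvector.
Proof.
move=> oc dy Sy; rewrite /grassmann_section; case: xgetP => [X _ [c' [oc' d'y ->]]|].
  exact: cls_unique.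
by move=> /(_ (cls A c y unit_kvector))[]; exists c.
Qed.

Let G := GkS A S O.
Let f := grassmann_section.

Lemma GkSE : G = f @` S.
Proof.
apply/seteqP; split=> X.
  move=> [_ [y [c [Sy ac dy Oc ->]]]]; exists y => //.
  by rewrite grassmann_liftE // /f (@grassmann_sectionE c).
move=> [y Sy <-]; have [c oc dy] := oriented_adapted_exists Sy.
rewrite /f (grassmann_sectionE oc dy Sy); case: (oc) => ac Oc; split.
  exact: (cls_grassmann A_on A_compat ac.1 dy unit_kvector_neq0).
by exists y, c; split=> //; rewrite grassmann_liftE.
Qed.

(** A class of non-zero k-vectors remembers its base point; injectivity of the section follows. *)
Lemma section_base y c p w : S y -> A c -> cdom c p -> w <> 0 ->
  f y = cls A c p w -> y = p.
Proof.
move=> Sy Ac dp w0; have [c' oc' dy'] := oriented_adapted_exists Sy.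
rewrite /f (grassmann_sectionE oc' dy' Sy) => /esym e.
exact: esym (cls_base A_on A_compat Ac dp w0 e).
Qed.

Lemma section_bij : set_bij S G f.
Proof.
split; first by move=> y Sy; rewrite GkSE; exists y.
  move=> y y'; rewrite !inE => Sy Sy' e; have [c oc dy] := oriented_adapted_exists Sy'.
  apply: (section_base Sy oc.1.1 dy unit_kvector_neq0).
  by rewrite e /f (grassmann_sectionE oc dy Sy').
by rewrite GkSE.
Qed.

(** * Smooth structure and orientation of the image of the section *)

Let AG := grassmann_atlas A k.
Let fib c := fibred_chart A c multiindex_first.

Let kgr : (k <= grassmann_dim m k)%N. Proof. exact: leq_trans km (leq_addr _ _). Qed.

Lemma AG_on C : AG C -> chart_on (grassmann A k) C. Proof. by case. Qed.

Lemma fibred_domE c y : oriented_adapted c -> S y ->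
  cdom (fib c) (f y) <-> cdom c y.
Proof.
move=> oc Sy; have Ac := oc.1.1; split.
  move=> /(fibred_domP A_on A_compat _ _ Ac)[p [w [dp w1 e]]].
  by rewrite (section_base Sy Ac dp (neq0_nu w1) e).
move=> dy; apply/(fibred_domP A_on A_compat _ _ Ac).
exists y, unit_kvector; split=> //; first exact: unit_kvector1.
exact: grassmann_sectionE.
Qed.

Lemma fibred_sectionE c y : oriented_adapted c -> cdom c y -> S y ->
  fib c (f y) = fibred_encode multiindex_first (c y) unit_kvector.
Proof.
move=> oc dy Sy; rewrite /f (grassmann_sectionE oc dy Sy).
exact: (fibredE1 A_on A_compat oc.1.1 dy unit_kvector1).
Qed.

Lemma fibred_adapted c : oriented_adapted c -> adapted AG k G (fib c).
Proof.
move=> oc; have [Ac sl] := oc.1; split.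
  exact: (fibred_grassmann_atlas A_on A_compat).
apply/seteqP; split=> X.
  rewrite GkSE => -[+ [y Sy yX]]; rewrite -{X}yX => dX; split=> // j kj.
  have dy := (fibred_domE oc Sy).1 dX; rewrite (fibred_sectionE oc dy Sy).
  case: (split_ordP j) kj => i -> /= ki.
    rewrite row_mxEl; have : (cdom c `&` S) y by [].
    by rewrite sl => -[_ ->].
  (* The fibre coordinates are indexed by [lift], which skips the first multi-index, so each is a
     zero component of the unit k-vector. *)
  rewrite row_mxEr mxE unit_kvectorE -(inj_eq enum_rank_inj) enum_valK.
  by rewrite (negPf (neq_lift _ _)).
move=> [/(fibred_domP A_on A_compat _ _ Ac)[p [w [dp w1 XE]]] z].
have FX : fib c X = fibred_encode multiindex_first (c p) w.
  by rewrite XE; exact: (fibredE1 A_on A_compat Ac dp w1).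
have Sp : S p.
  suff : (cdom c `&` S) p by case.
  rewrite sl; split=> // j kj; have := z (lshift _ j) kj.
  by rewrite FX row_mxEl.
have wE : w = unit_kvector.
  apply/ffunP => J; rewrite unit_kvectorE; case: eqVneq => [<- //|nJ].
  case: (unliftP (enum_rank multiindex_first) (enum_rank J)) => [j e|e]; last first.
    by move: nJ; rewrite (enum_rank_inj e) eqxx.
  (* Fibre coordinates come after the m base coordinates, so their index is at least m >= k and they
     vanish. *)
  have := z (rshift _ j) (leq_trans km (leq_addr _ _)).
  by rewrite FX row_mxEr mxE -e enum_rankK.
split; first by apply/(fibred_domP A_on A_compat _ _ Ac); exists p, w.
by rewrite GkSE; exists p; rewrite // XE wE /f (grassmann_sectionE oc dp Sp).
Qed.

Lemma GkS_submanifold : submanifold AG k G.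
Proof.
rewrite GkSE => _ [y Sy <-]; have [c oc dy] := oriented_adapted_exists Sy.
exists (fib c); last exact/fibred_domE.
by rewrite -GkSE; exact: fibred_adapted.
Qed.

Let AG' := submanifold_atlas AG k G.
Let rfib c := restrict_chart k G (fib c).

Let AG'_compat c1 c2 : AG' c1 -> AG' c2 -> compatible c1 c2.
Proof. exact: (submanifold_atlas_compatible kgr AG_on GkS_submanifold). Qed.

Let AG'_inj c : AG' c -> cinj c. Proof. by case=> -[]. Qed.
Let AG'_sub c : AG' c -> cdom c `<=` G. Proof. by case=> -[]. Qed.

Lemma restrict_fibred_atlas c : oriented_adapted c -> AG' (rfib c).
Proof.
move=> oc; apply: (restrict_submanifold_atlas kgr AG_on (fibred_adapted oc)) => C aC.
apply: compatibleC; case: aC.1 => _; apply.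
by exists c, multiindex_first; split=> //; exact: oc.1.1.
Qed.

Let pull (c' : chart R (set (kvector R Y m k)) k) := pullback_chart S f c'.

Let pull_inj c' : AG' c' -> cinj (pull c').
Proof. move=> /AG'_inj ic; exact: (pullback_inj section_bij ic). Qed.

Lemma pullback_restrict_fibred c : oriented_adapted c ->
  eq_chart (restrict_chart k S c) (pull (rfib c)).
Proof.
move=> oc; split.
  apply/seteqP; split=> y.
    move=> [dy Sy]; split=> //; split; first exact/fibred_domE.
    by rewrite GkSE; exists y.
  by move=> [Sy [dX _]]; split=> //; apply/(fibred_domE oc Sy).
move=> y [dy Sy].
have e : resize k (fib c (f y)) = resize k (fibred_encode multiindex_first (c y) unit_kvector).
  by rewrite fibred_sectionE.
exact: etrans (esym (resize_row_mx _ _ km)) (esym e).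
Qed.

(** At each point the restriction of an oriented adapted chart is an intermediate chart: it belongs
    to the atlas of S and agrees with a pulled back chart of G^k S, so the section is the identity
    in these coordinates. *)
Lemma section_diffeomorphism : diffeomorphism S AS G AG' f.
Proof.
split; first exact: section_bij.
move=> c c' Ac Ac'; apply: (compatible_trans (AS_inj Ac) (pull_inj Ac')) => p dp [Sp d'p].
have [c0 oc0 d0p] := oriented_adapted_exists Sp.
have ASr := restrict_AS oc0.1.
exists (restrict_chart k S c0); split=> //; first exact: AS_inj.
  exact: AS_compat.
apply: (eq_chart_compatible (eq_chart_sym (pullback_restrict_fibred oc0))
  (conj erefl (fun _ _ => erefl))).
have Ar := restrict_fibred_atlas oc0.
exact: (pullback_compatible section_bij (AG'_sub Ar) (AG'_sub Ac') (AG'_compat Ar Ac')).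
Qed.

(** With this definition the section preserves orientation by construction; what remains is that
    such charts cover G^k S and satisfy the fixed-point equation. *)
Definition pushed_orientation : set (chart R (set (kvector R Y m k)) k) :=
  [set c' | AG' c' /\ forall c, O c -> positively_related c (pull c')].
Let O' := pushed_orientation.

Let posdet_pull c1 c2 p : AG' c1 ->
  posdet (pull c1) (pull c2) p <-> posdet c1 c2 (f p).
Proof.
by move=> A1; rewrite /posdet (pullback_transition section_bij c2 (AG'_sub A1)).
Qed.

Let pull_compat c1 c2 : AG' c1 -> AG' c2 -> compatible (pull c1) (pull c2).
Proof.
move=> A1 A2.
exact: (pullback_compatible section_bij (AG'_sub A1) (AG'_sub A2) (AG'_compat A1 A2)).
Qed.

Let pull_open c : AG' c -> open (pull c @` cdom (pull c)).
Proof.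
by move=> Ac; apply: (pullback_open section_bij (AG'_sub Ac)); case: Ac => -[].
Qed.

Lemma restrict_fibred_positive c : oriented_adapted c -> O' (rfib c).
Proof.
move=> oc; split; first exact: restrict_fibred_atlas.
move=> o Oo; apply: (eq_chart_positively_related (conj erefl (fun _ _ => erefl))
  (pullback_restrict_fibred oc)).
exact: O_pos Oo oc.2.
Qed.

Lemma pushed_orientation_GkS : orientation G AG' O'.
Proof.
split.
  rewrite GkSE => _ [y Sy <-]; have [c oc dy] := oriented_adapted_exists Sy.
  exists (rfib c); first exact: restrict_fibred_positive.
  split; first exact/fibred_domE.
  by rewrite GkSE; exists y.
apply/seteqP; split=> c1.
  move=> [A1 pos1]; split=> // c2 [A2 pos2] X d1 d2.
  have [y Sy yX] : (f @` S) X by rewrite -GkSE; exact: AG'_sub d1.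
  rewrite -{X}yX in d1 d2 *.
  (* Two charts of [O'] are compared through a positive chart of S at the base point. *)
  have [ o Oo doy] := O_ori.1 y Sy; have Ao := O_AS Oo.
  have co1 := section_diffeomorphism.2 _ _ Ao A1.
  have co2 := section_diffeomorphism.2 _ _ Ao A2.
  have dp1 : cdom (pull c1) y := conj Sy d1.
  have dp2 : cdom (pull c2) y := conj Sy d2.
  apply: (posdet_pull c2 y A1).1.
  apply: (posdet_trans (pull_inj A1) (AS_inj Ao) (compatibleC co1) co2 dp1 doy dp2).
    exact: (posdet_sym (AS_inj Ao) (pull_inj A1) (AS_open Ao) co1 doy dp1 (pos1 o Oo y doy dp1)).
  exact: pos2 o Oo y doy dp2.
move=> [A1 pos1]; split=> // o Oo y doy [Sy d1y].
(* Conversely [o] and [c1] are compared through a restricted fibred chart, which lies in [O']. *)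
have [c oc dy] := oriented_adapted_exists Sy.
have [Ar posr] := restrict_fibred_positive oc.
have Ao := O_AS Oo.
have dr : cdom (rfib c) (f y).
  by split; [exact/fibred_domE|rewrite GkSE; exists y].
have dpr : cdom (pull (rfib c)) y := conj Sy dr.
have dp1 : cdom (pull c1) y := conj Sy d1y.
apply: (posdet_trans (AS_inj Ao) (pull_inj Ar) (section_diffeomorphism.2 _ _ Ao Ar)
  (pull_compat Ar A1) doy dpr dp1); first exact: posr o Oo y doy dpr.
apply: (posdet_sym (pull_inj A1) (pull_inj Ar) (pull_open A1) (pull_compat A1 Ar) dp1 dpr).
apply: (posdet_pull (rfib c) y A1).2; exact: pos1 (restrict_fibred_positive oc) _ d1y dr.
Qed.

End Oriented.

Theorem theorem1 (R : realType) (Y : topologicalType) (m k : nat)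
    (A : set (chart R Y m)) (S : set Y) (O : set (chart R Y k)) :
  smooth_manifold A ->
  (1 <= k)%N -> (k <= m)%N ->
  submanifold A k S ->
  orientation S (submanifold_atlas A k S) O ->
  submanifold (grassmann_atlas A k) k (GkS A S O) /\
  exists2 O' : set (chart R (set (kvector R Y m k)) k),
    orientation (GkS A S O)
      (submanifold_atlas (grassmann_atlas A k) k (GkS A S O)) O' &
    exists2 f : Y -> set (kvector R Y m k),
      diffeomorphism S (submanifold_atlas A k S)
        (GkS A S O)
        (submanifold_atlas (grassmann_atlas A k) k (GkS A S O)) f &
      orientation_preserving S O O' f.
Proof.
move=> [_ _ _ _ A_max] k_gt0 km A_sub O_ori.
split; first exact: GkS_submanifold.
exists (pushed_orientation A S O); first exact: pushed_orientation_GkS.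
exists (grassmann_section A S O); first exact: section_diffeomorphism.
by move=> c c' Oc [_ pos]; exact: pos.
Qed.
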